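(* Let $(r_n)_{n\ge 0}$ be an admissible sequence of radii, and let $K_n$ and $K$ be the associated random Cantor sets in either the synchronized rotations model or the independent rotations model. Then, in both models, $$\mathbb{E}[\mathrm{Fav}(K_n)]\approx\left(\sum_{j=0}^n\frac{1}{4^j r_j}\right)^{-1}\qquad\text{for all } n\ge 0,$$ and $$\mathbb{E}[\mathrm{Fav}(K(r))]\approx\left(\sum_{j=0}^{n-1}\frac{1}{4^j r_j}+\frac{1}{4^n r}\right)^{-1}\qquad\text{for all } n\ge 0 \text{ and all } r>0 \text{ with } r\in[r_n,r_{n-1}].$$
   Context: Favard length: for $\theta\in[0,\pi]$ let $\mathrm{proj}_\theta(x)=x\cdot(\cos\theta,\sin\theta)$ for $x\in\mathbb{R}^2$; for a Borel set $E\subset\mathbb{R}^2$, $\mathrm{Fav}(E)=\int_0^\pi|\mathrm{proj}_\theta(E)|\,d\theta$, where $|\cdot|$ is one-dimensional Lebesgue measure. For a compact set $E$ and $r>0$, $E(r)=\{x:\mathrm{dist}(x,E)\le r\}$. Admissible sequence: a sequence $r_0\ge r_1\ge r_2\ge\cdots$ of nonnegative reals with $r_{n+1}\le \frac13 r_n$ for all $n\ge0$. The degenerate case in which $r_n=0$ for all $n$ from some index on is allowed. Conventions: $r_{-1}=\infty$, $1/0=\infty$, $1/\infty=0$. Cantor set: let $[4]=\{0,1,2,3\}$, let $[4]^*$ be the set of finite words over $[4]$ (including the empty word $\varnothing$), and let $|\mathbf{i}|$ be the length of $\mathbf{i}$. Write $B(x,r)$ for the closed disc and $u(t)=(\cos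 t,\sin t)$. Given an admissible sequence $(r_n)$ and angles $(\omega_{\mathbf i})_{\mathbf i\in[4]^*}$ in $[0,2\pi]$, define $D_\varnothing=B(0,r_0)$, and if $|\mathbf i|=k$ and $D_{\mathbf i}=B(c_{\mathbf i},r_k)$, then for $j\in[4]$ put $D_{\mathbf i j}=B\big(c_{\mathbf i}+(r_k-r_{k+1})\,u(\omega_{\mathbf i}+\tfrac{2\pi j}{4}),\,r_{k+1}\big)$. Set $K_n=\bigcup_{|\mathbf i|=n}D_{\mathbf i}$ and $K=\bigcap_{n\ge0}K_n$. Random models (radii fixed, angles random). Synchronized rotations model: $\omega_0,\omega_1,\dots$ are i.i.d. uniform in $[0,2\pi]$ and $\omega_{\mathbf i}=\omega_{|\mathbf i|}$. Independent rotations model: all $\omega_{\mathbf i}$, $\mathbf i\in[4]^*$, are independent and uniform in $[0,2\pi]$. $X\approx Y$ means $c\,Y\le X\le C\,Y$ with absolute constants $0<c\le C<\infty$ (independent of the sequence, of $n$ and of $r$). *)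

(* Defs.v *)
From HB Require Import structures.
From mathcomp Require Import all_boot all_order all_algebra.
From mathcomp Require Import all_classical all_reals all_analysis.

Set Implicit Arguments.
Unset Strict Implicit.
Unset Printing Implicit Defensive.

Import Order.TTheory GRing.Theory Num.Theory.
Import numFieldNormedType.Exports.

Local Open Scope classical_set_scope.
Local Open Scope ring_scope.

Section plane.
Context {R : realType}.
Implicit Types (x y : R * R) (E : set (R * R)).

(* The canonical norm of [R * R] is the sup norm, hence this definition. *)
Definition eucl_dist x y : R :=
  Num.sqrt ((x.1 - y.1) ^+ 2 + (x.2 - y.2) ^+ 2).

Definition disc x (rho : R) : set (R * R) := [set y | eucl_dist x y <= rho].

Definition dist_to_set x E : \bar R :=
  ereal_inf [set (eucl_dist x y)%:E | y in E].

Definition neighborhood E (rho : R) : set (R * R) :=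
  [set x | (dist_to_set x E <= rho%:E)%E].

Definition line_proj (theta : R) x : R := x.1 * cos theta + x.2 * sin theta.

Definition Fav E : \bar R :=
  (\int[lebesgue_measure]_(theta in `[0%R, pi])
     lebesgue_measure (line_proj theta @` E))%E.

Definition unit_vector (t : R) : R * R := (cos t, sin t).

End plane.

(* Words over [4] are stored with their last letter first: [j :: i] encodes
   the word written i j. *)
Notation word := (seq 'I_4).

Section cantor_set.
Context {R : realType}.
Implicit Types (r : nat -> R) (omega : word -> R).

Definition admissible r : Prop :=
  [/\ forall n, 0 <= r n,
      forall n, r n.+1 <= r n
    & forall n, r n.+1 <= 3^-1 * r n].

Definition prev_radius r (n : nat) : \bar R :=
  if n is m.+1 then (r m)%:E else +oo%E.

Fixpoint disc_center r omega (i : word) : R * R :=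
  if i is j :: i' then
    disc_center r omega i' + (r (size i') - r (size i').+1) *:
      unit_vector (omega i' + 2 * pi * j%:R / 4)
  else (0, 0).

Definition cantor_disc r omega (i : word) : set (R * R) :=
  disc (disc_center r omega i) (r (size i)).

Definition cantor_level r omega (n : nat) : set (R * R) :=
  \bigcup_(i in [set i : word | size i = n]) cantor_disc r omega i.

Definition cantor_limit r omega : set (R * R) :=
  \bigcap_n cantor_level r omega n.

End cantor_set.

Section random_models.
Context {d : measure_display} {Omega : measurableType d} {R : realType}.
Variable P : probability Omega R.

Lemma two_pi_gt0 : (0 : R) < 2 * pi.
Proof. by rewrite mulr_gt0 ?pi_gt0. Qed.

Definition uniform_angle (X : {RV P >-> R}) : Prop :=
  forall A : set R, measurable A ->
    distribution P X A = uniform_prob two_pi_gt0 A.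

Definition mutually_independent (I : eqType) (X : I -> {RV P >-> R}) : Prop :=
  forall (s : seq I) (A : I -> set R), uniq s ->
    (forall i, measurable (A i)) ->
    P (\bigcap_(i in [set` s]) (X i @^-1` A i)) =
    (\prod_(i <- s) P (X i @^-1` A i))%E.

Definition iid_uniform_angles (I : eqType) (X : I -> {RV P >-> R}) : Prop :=
  mutually_independent X /\ forall i, uniform_angle (X i).

Definition synchronized_rotations (omega : word -> {RV P >-> R}) : Prop :=
  exists2 a : nat -> {RV P >-> R}, iid_uniform_angles a &
    forall i w, omega i w = a (size i) w.

Definition independent_rotations (omega : word -> {RV P >-> R}) : Prop :=
  iid_uniform_angles omega.

(* The expectation of a [0, +oo]-valued function; the library's ['E_P[X]] is
   this integral for real-valued [X]. *)
Definition mean (X : Omega -> \bar R) : \bar R := (\int[P]_w X w)%E.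

End random_models.

Section comparison.
Context {R : realType}.
Local Open Scope ereal_scope.

(* In [\bar R], [0^-1 = +oo] and [+oo^-1 = 0]. *)
Definition recip_sum (r : nat -> R) (n : nat) : \bar R :=
  \sum_(0 <= j < n) ((4 ^+ j * r j)%R%:E)^-1.

Definition comparable_with (c C : R) (X Y : \bar R) : Prop :=
  c%:E * Y <= X /\ X <= C%:E * Y.

End comparison.

(* Main.v *)
Require Import Defs.
From mathcomp Require Import all_boot all_order all_algebra.
From mathcomp Require Import all_classical all_reals all_analysis.
From mathcomp Require Import measurable_realfun ring lra.
Import Order.TTheory GRing.Theory Num.Theory.
Import numFieldNormedType.Exports.

(** The set is studied through its projection on a fixed line, in the direction
    theta. The discs of level n become intervals, and up to constants the Favard
    length is the integral over theta of the length of a union of intervals of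
    equal radius delta around the projected centres: a union of discs is
    sandwiched in this way with delta a small fraction of its radius, because
    doubling the intervals at most doubles the length of the union. It remains
    to show that for every theta the mean length of the union is comparable with
    the inverse of
      H = sum over j < n of 1 / (4 ^ j r_j) + 1 / (4 ^ n delta),
    which is also given by the recursion H_k = 1 / r_k + H_{k+1} / 4 along the
    levels of the tree, starting from 1 / delta at the leaves ([resistance]).

    Both bounds are recursions on the height of the tree, and rest on the same
    fact: the angle at a node is uniform and independent of all angles below it,
    so it may be averaged out with the four subtrees frozen
    ([ge0_integral_root]). Averaging it moves the projections of two subtrees of
    a node of level k relative to each other over a range of order r_k.

    Upper bound ([mean_shadow_le]). The children 0 and 2 are displaced by
    2 a cos (t - theta), with a = r_k - r_{k+1}. This is a 2a-Lipschitz function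
    of t onto [-2a, 2a], so the mean overlap of two sets A and B moved in this
    way is at least |A| |B| / (4 pi a) ([mean_overlap_ge]). The lengths of two
    sibling subtrees are equal in the synchronized model and independent in the
    other one; in both cases the mean of their product is at least the product
    of the means. Hence the mean length e_k of a subtree of level k satisfies
    e_k <= 4 e_{k+1} - c e_{k+1} ^ 2 / r_k, and large constant multiples
    of 1 / H are supersolutions of this recursion ([upper_recursion]).

    Lower bound ([mean_shadow_ge]). If f counts the intervals containing a
    point, the integral of f is not random, and that of f ^ 2 is controlled by
    the number of pairs of intervals that meet. Two words that part at level k
    are displaced by a (p cos t + q sin t) plus a term that does not depend on
    the angle t and is at most a, because the ratio of consecutive radii is at
    most 1/3. Since p ^ 2 + q ^ 2 >= 2, the intervals can only meet where the
    trigonometric polynomial has a large derivative, and this has probability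
    O(delta / r_k) ([anticoncentration]). Summing over pairs gives the mean of
    the integral of f ^ 2 up to the factor H ([close_pairs_le]), and the second
    moment method concludes.

    The passage from the limit set to discs uses that every disc of the
    construction contains a point of the limit set ([cantor_limit_meets_disc]).
    The bounds for unions of discs carry over to its neighborhoods because the
    Lebesgue outer measure and the integral of nonnegative functions are
    monotone, whether or not the larger set or function is measurable. *)

Local Open Scope classical_set_scope.
Local Open Scope ring_scope.
Set Implicit Arguments.
Unset Strict Implicit.
Unset Printing Implicit Defensive.

(** * Lebesgue measure of arbitrary sets *)

Section outer_lebesgue.
Context {R : realType}.
Implicit Types (A B S : set R) (g : R -> R).
Local Notation mu := (@lebesgue_measure R).

(** The measure is an outer measure on all subsets of the line. Monotonicity and
    subadditivity are used without measurability, since projections of the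
    random sets are only bounded above and below by measurable ones. *)
Lemma le_lebesgue_measure A B : A `<=` B -> (mu A <= mu B)%E.
Proof. by move=> AB; exact: le_mu_ext. Qed.

Lemma lebesgue_measureU A B : (mu (A `|` B) <= mu A + mu B)%E.
Proof.
exact: (outer_measureU2 (mu_ext (@wlength R idfun))).
Qed.

Lemma lebesgue_measure_bigcup (F : nat -> set R) :
  (mu (\bigcup_n F n) <= \sum_(n <oo) mu (F n))%E.
Proof. exact: (outer_measure_sigma_subadditive (mu_ext (@wlength R idfun))). Qed.

Lemma lebesgue_measure_le_diameter S (D : R) :
  0 <= D -> (forall x y, S x -> S y -> `|x - y| <= D) -> (mu S <= D%:E)%E.
Proof.
move=> D0 SD; have [->|/set0P[x0 Sx0]] := eqVneq S set0.
  by rewrite measure0 lee_fin.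
have lbS : has_inf S.
  split; first by exists x0.
  exists (x0 - D) => y Sy; have := SD _ _ Sx0 Sy.
  by rewrite ler_norml => /andP[_]; lra.
apply: (@le_trans _ _ (mu `[inf S, inf S + D])).
  apply: le_lebesgue_measure => y Sy /=; rewrite in_itv/=.
  rewrite (ge_inf lbS.2 Sy)/= -lerBlDr; apply: lb_le_inf; first by exists x0.
  move=> z Sz; have := SD _ _ Sy Sz.
  by rewrite ler_norml => /andP[_]; lra.
rewrite lebesgue_measure_itv/= lte_fin; case: ifPn => // _.
by rewrite -EFinB lee_fin; lra.
Qed.

(** A cover of [S] by intervals is mapped piece by piece: the image of the part
    of [S] inside an interval of length l has diameter at most [L * l]. *)
Lemma lebesgue_measure_lipschitz_image (L : R) S g : 0 < L ->
  (forall x y, S x -> S y -> `|g x - g y| <= L * `|x - y|) ->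
  (mu (g @` S) <= L%:E * mu S)%E.
Proof.
move=> L0 gL.
rewrite muleC -lee_pdivrMr//; apply: le_ereal_inf_tmp => _ [A [mA SA] <-].
rewrite lee_pdivrMr// muleC -nneseriesZl//.
apply: (@le_trans _ _ (mu (\bigcup_n (g @` (S `&` A n))))).
  apply: le_lebesgue_measure => _ [x Sx <-].
  by have [n _ Anx] := SA _ Sx; exists n => //; exists x.
apply: (le_trans (lebesgue_measure_bigcup _)).
apply: lee_nneseries => [n _ _ //|n _].
have [[a b] _ <-] := mA n; rewrite /= wlength_itv/=.
have [ab|ba] := ltP a b; last first.
  rewrite lte_fin ltNge ba/= mule0.
  rewrite set_itv_ge ?setI0 ?image_set0 ?measure0//.
  by rewrite bnd_simp -leNgt.
rewrite lte_fin ab -EFinB -EFinM; apply: lebesgue_measure_le_diameter.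
  by apply: mulr_ge0; lra.
move=> _ _ [x [Sx +] <-] [y [Sy +] <-]; rewrite /= !in_itv/= => /andP[? ?] /andP[? ?].
apply: (le_trans (gL _ _ Sx Sy)); rewrite ler_pM2l// ler_norml.
by apply/andP; split; lra.
Qed.

(** Translations are 1-Lipschitz in both directions. *)
Lemma lebesgue_measure_translate A (t : R) :
  mu [set x | A (x - t)] = mu A.
Proof.
have le B s : (mu [set x | B (x - s)%R] <= mu B)%E.
  rewrite -[leRHS]mul1e.
  apply: le_trans (lebesgue_measure_lipschitz_image (g := +%R s) ltr01 _).
    by apply: le_lebesgue_measure => x /= Bx; exists (x - s) => //; ring.
  by move=> x y _ _; rewrite opprD addrACA subrr add0r mul1r.
apply/le_anti; rewrite le/= -[leLHS](_ : mu [set x | [set x | A (x - t)] (x - - t)] = _).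
  exact: le.
by congr (mu _); apply/seteqP; split => x /=; rewrite opprK addrK.
Qed.

End outer_lebesgue.

Section lower_integral.
Context d (T : measurableType d) (R : realType) (m : {measure set T -> \bar R}).
Local Open Scope ereal_scope.

(** For a nonnegative function the integral is a supremum over simple functions
    below it, so monotonicity is free of measurability. This is what makes the
    mean Favard length of a random neighborhood accessible. *)
Lemma ge0_le_integral_lower (D : set T) (f g : T -> \bar R) :
  (forall x, D x -> 0 <= f x) -> (forall x, D x -> f x <= g x) ->
  \int[m]_(x in D) f x <= \int[m]_(x in D) g x.
Proof.
move=> f0 fg; rewrite !(integral_mkcond D).
have le x : (f \_ D) x <= (g \_ D) x.
  by rewrite /patch; case: ifPn => //; rewrite inE => /fg.
have f0' x : 0 <= (f \_ D) x.
  by rewrite /patch; case: ifPn => //; rewrite inE => /f0.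
rewrite !ge0_integralTE//; last by move=> x; exact: le_trans (le x).
apply: ereal_sup_le => _ [h hf <-]; exists h => // x.
exact: le_trans (hf x) (le x).
Qed.

End lower_integral.

(** * Unions of intervals of equal length *)

Section covers.
Context {R : realType}.
Local Notation mu := (@lebesgue_measure R).

Definition interval_cover (I : Type) (s : seq I) (y : I -> R) (delta : R) : set R :=
  [set x | has (fun u => `|x - y u| <= delta) s].

Lemma centered_segmentE (c delta : R) :
  [set x | `|x - c| <= delta] = `[c - delta, c + delta]%classic.
Proof.
by apply/seteqP; split => x /=; rewrite in_itv/= ler_distl.
Qed.

Lemma lebesgue_measure_segment (c delta : R) : 0 <= delta ->
  mu [set x | `|x - c| <= delta] = (2 * delta)%:E.
Proof.
move=> d0; rewrite centered_segmentE lebesgue_measure_itv/= lte_fin.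
case: ltP => h; first by rewrite -EFinB; congr (_%:E); ring.
by congr (_%:E); lra.
Qed.

Section measurability.
Context d (T : measurableType d) (I : Type) (y : I -> T -> R).
Hypothesis my : forall u, measurable_fun setT (y u).

(** Joint measurability in the parameter and the point of the line is what
    Tonelli needs in order to exchange the length of a random union of
    intervals with the expectation. *)
Lemma measurable_interval_cover_joint (s : seq I) (delta : R) :
  measurable [set p : T * R | interval_cover s (y ^~ p.1) delta p.2].
Proof.
elim: s => [|u s IHs].
  rewrite (_ : [set p | _] = set0); first exact: measurable0.
  by apply/seteqP; split.
rewrite (_ : [set p | _] = ((fun p : T * R => `|p.2 - y u p.1|) @^-1` `]-oo, delta])
   `|` [set p : T * R | interval_cover s (y ^~ p.1) delta p.2]).
  apply: measurableU => //; rewrite -[X in measurable X]setTI.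
  have mf : measurable_fun setT (fun p : T * R => `|p.2 - y u p.1|).
    apply: measurableT_comp => //.
    apply: measurable_funB; first exact: measurable_snd.
    by apply: measurableT_comp => //; exact: measurable_fst.
  by apply: mf => //; exact: measurable_itv.
apply/seteqP; split => p; rewrite /interval_cover /= ?in_itv/=.
  by move=> /orP[|]; [left|right].
by move=> [->//|->]; rewrite orbT.
Qed.

Lemma measurable_fun_interval_cover (s : seq I) (delta : R) :
  measurable_fun setT (fun t => mu (interval_cover s (y ^~ t) delta)).
Proof.
have := @measurable_fun_xsection _ _ _ _ _ mu _ (measurable_interval_cover_joint s delta).
apply: eq_measurable_fun => t _ /=; congr (mu _).
by apply/seteqP; split=> x; rewrite /xsection/= inE.
Qed.

End measurability.

Section cover_measure.
Context (I : Type).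
Implicit Types (s : seq I) (y : I -> R).

Lemma measurable_interval_cover s y delta : measurable (interval_cover s y delta).
Proof.
have := @measurable_interval_cover_joint _ unit I (fun u _ => y u) _ s delta.
move=> /(_ (fun u => measurable_cst _)) /(measurable_xsection tt).
congr measurable; by apply/seteqP; split=> x; rewrite /xsection/= inE.
Qed.

Lemma interval_cover_cons u s y delta :
  interval_cover (u :: s) y delta = [set x | `|x - y u| <= delta] `|` interval_cover s y delta.
Proof.
apply/seteqP; split => x; rewrite /interval_cover /=; first by move/orP.
by move=> ?; apply/orP.
Qed.

Lemma lebesgue_measure_cover_le s y delta : 0 <= delta ->
  (mu (interval_cover s y delta) <= ((size s)%:R * (2 * delta))%:E)%E.
Proof.
move=> d0; elim: s => [|u s IHs].
  by rewrite mul0r (_ : interval_cover _ _ _ = set0) ?measure0//; apply/seteqP; split.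
rewrite interval_cover_cons; apply: (le_trans (lebesgue_measureU _ _)).
rewrite lebesgue_measure_segment//.
apply: (le_trans (leeD2l _ IHs)); rewrite -EFinD lee_fin/= -[(size s).+1%:R]natr1.
by lra.
Qed.

Lemma interval_cover_shift s y delta t :
  interval_cover s (fun u => y u + t) delta = [set x | interval_cover s y delta (x - t)].
Proof.
rewrite /interval_cover; apply/funext => x /=; rewrite propeqE.
have -> // : has (fun u => `|x - (y u + t)| <= delta) s =
    has (fun u => `|x - t - y u| <= delta) s.
by apply: eq_has => u /=; rewrite opprD addrA addrAC.
Qed.

Lemma lebesgue_measure_cover_shift s y delta t :
  mu (interval_cover s (fun u => y u + t) delta) = mu (interval_cover s y delta).
Proof. by rewrite interval_cover_shift lebesgue_measure_translate. Qed.

(** An interval of radius [2 * delta] is the union of the two translates by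
    [delta] and [- delta] of the interval of radius [delta] with its centre. *)
Lemma lebesgue_measure_cover_double s y delta : 0 <= delta ->
  (mu (interval_cover s y (2 * delta)) <= 2%:E * mu (interval_cover s y delta))%E.
Proof.
move=> d0.
have sub : interval_cover s y (2 * delta) `<=`
    interval_cover s (fun u => y u + delta) delta `|` interval_cover s (fun u => y u - delta) delta.
  move=> x; rewrite /interval_cover/=; elim: s => [//|u s IHs] /= /orP[h|].
    have [xu|xu] := leP (y u) x; [left|right]; apply/orP; left.
    - by move: h; rewrite !ler_distl => /andP[? ?]; apply/andP; split; lra.
    - by move: h; rewrite !ler_distl => /andP[? ?]; apply/andP; split; lra.
  by move=> /IHs [] /= ->; [left|right]; rewrite orbT.
apply: (le_trans (le_lebesgue_measure sub)).
apply: (le_trans (lebesgue_measureU _ _)).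
by rewrite !lebesgue_measure_cover_shift mule_natl mule2n.
Qed.

Lemma lebesgue_measure_cover_dilate s y delta k : 0 <= delta ->
  (mu (interval_cover s y (2 ^+ k * delta)) <= (2 ^+ k)%:E * mu (interval_cover s y delta))%E.
Proof.
move=> d0; elim: k => [|k IHk]; first by rewrite !mul1r mul1e.
rewrite exprS -mulrA; apply: (le_trans (lebesgue_measure_cover_double _ _ _)).
  by rewrite mulr_ge0// exprn_ge0.
by rewrite EFinM -muleA lee_pmul2l.
Qed.

Lemma ge0_integral_sum_indic (J : Type) (t : seq J) (A : J -> set R) (a : R) :
  0 <= a -> (forall j, measurable (A j)) ->
  (\int[mu]_x (a * \sum_(j <- t) \1_(A j) x)%:E =
   a%:E * \sum_(j <- t) mu (A j))%E.
Proof.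
move=> a0 mA.
have mi j : measurable_fun setT (fun x => (\1_(A j) x)%:E : \bar R).
  by apply/measurable_EFinP; exact: measurable_indic.
under eq_integral do rewrite EFinM -sumEFin.
rewrite ge0_integralZl//; last 2 first.
  - by apply: emeasurable_sum.
  - by move=> x _; apply: sume_ge0 => j _; rewrite lee_fin.
rewrite ge0_integral_sum//; congr (_ * _)%E.
apply: eq_bigr => j _; rewrite integral_indic ?setIT;
  [by []|exact: measurableT|exact: mA].
Qed.

(** Second moment method. With f the number of intervals that contain a point,
    the indicator of the union dominates [2 * lambda * f - lambda ^+ 2 * f ^+ 2]
    by [(lambda * f - 1) ^+ 2 >= 0]. Integrating, f contributes the total
    length, and f squared the overlaps, at most [2 * delta] for each pair of
    intervals that meet. Keeping [lambda] free leaves an expression linear in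
    the number of pairs, so an expectation can be taken on both sides. *)
Lemma lebesgue_measure_cover_ge s y delta lambda : 0 <= delta -> 0 <= lambda ->
  ((2 * lambda * ((size s)%:R * (2 * delta)))%:E <= mu (interval_cover s y delta) +
   (lambda ^+ 2 * (2 * delta) *
    (\sum_(u <- s) \sum_(v <- s) (`|y u - y v| <= 2 * delta)%R%:R))%:E)%E.
Proof.
move=> d0 l0.
pose B u : set R := [set x | `|x - y u| <= delta].
have mB u : measurable (B u) by rewrite /B centered_segmentE; exact: measurable_itv.
pose B2 (p : I * I) := B p.1 `&` B p.2.
have mB2 p : measurable (B2 p) by exact: measurableI.
have {1}-> : (2 * lambda * ((size s)%:R * (2 * delta)))%:E =
    (\int[mu]_x (2 * lambda * \sum_(u <- s) \1_(B u) x)%:E)%E.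
  rewrite ge0_integral_sum_indic//; last by rewrite mulr_ge0.
  rewrite EFinM; congr (_ * _)%E.
  under eq_bigr do rewrite lebesgue_measure_segment//.
  by rewrite sumEFin big_const_seq count_predT iter_addr_0 mulr_natl.
pose s2 := [seq (u, v) | u <- s, v <- s].
apply: (@le_trans _ _ (mu (interval_cover s y delta) +
   (lambda ^+ 2)%:E * \sum_(p <- s2) mu (B2 p))%E); last first.
  apply: leeD2l; rewrite -mulrA [leRHS]EFinM.
  apply: lee_wpmul2l; first by rewrite lee_fin exprn_ge0.
  rewrite big_allpairs/= mulr_sumr -sumEFin; apply: lee_sum => u _.
  rewrite mulr_sumr -sumEFin; apply: lee_sum => v _.
  case: (leP (`|y u - y v|) (2 * delta)) => uv /=.
    rewrite mulr1 -(lebesgue_measure_segment (y u)) //.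
    by apply: le_lebesgue_measure => x [].
  rewrite mulr0 (_ : B2 _ = set0) ?measure0//.
  apply/seteqP; split => // x [] /=; rewrite /B /= !ler_distl.
  by move=> /andP[? ?] /andP[? ?]; move: uv; rewrite ltr_normr => /orP[]; lra.
rewrite -ge0_integral_sum_indic ?exprn_ge0//.
have mS (J : Type) (t : seq J) (A : J -> set R) (a : R) :
    (forall j, measurable (A j)) ->
    measurable_fun setT (fun x => (a * \sum_(j <- t) \1_(A j) x)%:E).
  move=> mA; apply/measurable_EFinP; apply: measurable_funM => //.
  by apply: measurable_sum => j; exact: measurable_indic.
have -> : mu (interval_cover s y delta) = (\int[mu]_x (\1_(interval_cover s y delta) x)%:E)%E.
  by rewrite integral_indic ?setIT;
    [by []|exact: measurableT|exact: measurable_interval_cover].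
rewrite -ge0_integralD//; last 3 first.
- by apply/measurable_EFinP; apply: measurable_indic; exact: measurable_interval_cover.
- by move=> x _; rewrite lee_fin mulr_ge0 ?exprn_ge0// sumr_ge0.
- exact: mS.
apply: ge0_le_integral_lower => x _.
  by rewrite lee_fin mulr_ge0 ?sumr_ge0// mulr_ge0.
rewrite -EFinD lee_fin.
have -> : \sum_(p <- s2) \1_(B2 p) x = (\sum_(u <- s) \1_(B u) x) ^+ 2 :> R.
  rewrite big_allpairs/= expr2 mulr_suml; apply: eq_bigr => u _.
  rewrite mulr_sumr; apply: eq_bigr => v _.
  by rewrite /B2/= indicI.
have [xc|xc] := boolP (x \in interval_cover s y delta).
  rewrite indicE xc; set f := \sum_(u <- s) _.
  by have := sqr_ge0 (lambda * f - 1); rewrite /=; lra.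
have -> : \sum_(u <- s) \1_(B u) x = 0 :> R.
  move: xc; rewrite notin_setE /interval_cover/=.
  elim: s {s2} => [|u s IHs]; first by rewrite big_nil.
  rewrite big_cons /= => /negP; rewrite negb_or => /andP[xu /negP/IHs ->].
  by rewrite addr0 indicE memNset//; exact/negP.
by rewrite indicE (negbTE xc) expr0n !mulr0 addr0.
Qed.

End cover_measure.
End covers.

(** * Independence *)

Section independent_pairs.
Context d (Omega : measurableType d) (R : realType) (P : probability Omega R).
Local Open Scope ereal_scope.

(** The joint law of an independent pair agrees with the product of the laws on
    rectangles, hence everywhere; Tonelli then separates the variables. *)
Lemma ge0_integral_independent_pair d1 d2 (T1 : measurableType d1)
    (T2 : measurableType d2) (Y1 : Omega -> T1) (Y2 : Omega -> T2)
    (F : T1 * T2 -> \bar R) :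
  measurable_fun setT Y1 -> measurable_fun setT Y2 ->
  (forall A B, measurable A -> measurable B ->
    P (Y1 @^-1` A `&` Y2 @^-1` B) = P (Y1 @^-1` A) * P (Y2 @^-1` B)) ->
  measurable_fun setT F -> (forall z, 0 <= F z) ->
  \int[P]_w F (Y1 w, Y2 w) = \int[P]_w2 \int[P]_w1 F (Y1 w1, Y2 w2).
Proof.
move=> mY1 mY2 indep mF F0.
pose X1 : {mfun Omega >-> T1} := mfun_Sub (mem_set mY1).
pose X2 : {mfun Omega >-> T2} := mfun_Sub (mem_set mY2).
have mY : measurable_fun setT (fun w => (Y1 w, Y2 w)).
  exact: measurable_fun_pair.
pose X : {mfun Omega >-> (T1 * T2)%type} := mfun_Sub (mem_set mY).
have prodE A : measurable A ->
    (distribution P X1 \x distribution P X2) A = distribution P X A.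
  apply: product_measure_unique => {}A B mA mB.
  exact: indep.
transitivity (\int[distribution P X]_z F z).
  by rewrite ge0_integral_distribution.
rewrite (eq_measure_integral (distribution P X1 \x distribution P X2)); last first.
  by move=> A mA _; first [exact: prodE | exact/esym/prodE].
rewrite fubini_tonelli2// ge0_integral_distribution//; last 2 first.
- exact: measurable_fun_fubini_tonelli_G.
- by move=> y; exact: integral_ge0.
apply: eq_integral => w _ /=; rewrite /fubini_G.
rewrite ge0_integral_distribution// => y.
by apply: measurableT_comp => //; exact: pair2_measurable.
Qed.

End independent_pairs.

Section blocks.
Context d (Omega : measurableType d) (R : realType) (P : probability Omega R).
Context (I : eqType) (X : I -> {RV P >-> R}).
Implicit Types (J : set I) (E F : set Omega).

Definition events_of J : set (set Omega) :=
  [set E | exists i A, [/\ J i, measurable A & E = X i @^-1` A]].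

(** A pi-system that generates the sigma-algebra of the variables with indices
    in [J], and on which independence is the definition. *)
Definition cylinders_of J : set (set Omega) :=
  [set E | exists (s : seq I) (A : I -> set R),
    [/\ uniq s, forall i, i \in s -> J i, forall i, measurable (A i)
      & E = \bigcap_(i in [set` s]) (X i @^-1` A i)]].

Lemma events_of_measurable J : events_of J `<=` measurable.
Proof.
by move=> _ [i [A [_ mA ->]]]; rewrite -[X in measurable X]setTI;
  exact: measurable_funP.
Qed.

Lemma cylinders_of_measurable J : cylinders_of J `<=` measurable.
Proof.
move=> _ [s [A [_ _ mA ->]]]; apply: fin_bigcap_measurable => // i _.
by rewrite -[X in measurable X]setTI; exact: measurable_funP.
Qed.

Lemma cylinders_of_setI J : setI_closed (cylinders_of J).
Proof.
move=> _ _ [s [A [us sJ mA ->]]] [t [B [ut tJ mB ->]]].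
exists (undup (s ++ t)), (fun i => (if i \in s then A i else setT) `&`
   (if i \in t then B i else setT)); split.
- exact: undup_uniq.
- by move=> i; rewrite mem_undup mem_cat => /orP[/sJ|/tJ].
- by move=> i; apply: measurableI; case: ifP.
apply/seteqP; split => w.
  move=> [sA tB] i /= _; split => /=; case: ifPn => // h; [exact: sA|exact: tB].
move=> h; split => i /= hi.
  by have := h i; rewrite /= mem_undup mem_cat hi => /(_ isT)[].
by have := h i; rewrite /= mem_undup mem_cat hi orbT => /(_ isT)[].
Qed.

Lemma events_of_cylinders J : <<s events_of J >> `<=` <<s cylinders_of J >>.
Proof.
apply: sub_sigma_algebra2 => _ [i [A [Ji mA ->]]].
exists [:: i], (fun=> A); split => //.
- by move=> j; rewrite inE => /eqP ->.
apply/seteqP; split => w /=; first by move=> h j /=; rewrite inE => /eqP ->.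
by apply; rewrite /= inE.
Qed.

Lemma cylinders_setT J : cylinders_of J setT.
Proof.
by exists [::], (fun=> setT); split => //; apply/seteqP; split.
Qed.

Hypothesis indepX : mutually_independent X.

Lemma cylinders_independent J1 J2 E F : J1 `&` J2 = set0 ->
  cylinders_of J1 E -> cylinders_of J2 F -> P (E `&` F) = (P E * P F)%E.
Proof.
move=> J12 [s [A [us sJ mA ->]]] [t [B [ut tJ mB ->]]].
have st i : i \in t -> i \notin s.
  move=> it; apply/negP => si.
  have : (J1 `&` J2) i by split; [exact: sJ|exact: tJ].
  by rewrite J12.
pose C i := if i \in s then A i else B i.
rewrite (_ : _ `&` _ = \bigcap_(i in [set` s ++ t]) (X i @^-1` C i)); last first.
  apply/seteqP; split => w.
    move=> [hs ht] i /=; rewrite mem_cat /C => /orP[si|ti].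
      by rewrite si; exact: hs.
    by rewrite (negbTE (st _ ti)); exact: ht.
  move=> h; split => i /= hi.
    by have := h i; rewrite /= mem_cat /C hi; exact.
  by have := h i; rewrite /= mem_cat /C hi orbT (negbTE (st _ hi)); exact.
rewrite indepX; last 2 first.
- by rewrite cat_uniq us ut andbT; apply/hasPn => i /st.
- by move=> i; rewrite /C; case: ifP.
rewrite indepX// indepX// big_cat/=; congr (_ * _)%E.
  by apply: eq_big_seq => i si; rewrite /C si.
by apply: eq_big_seq => i /st; rewrite /C => /negbTE ->.
Qed.

(** The product rule extends from cylinders to the generated sigma-algebras one
    argument at a time: with the other event fixed, both sides are finite
    measures that agree on a pi-system. *)
Lemma sigma_blocks_independent J1 J2 E F : J1 `&` J2 = set0 ->
  <<s events_of J1 >> E -> <<s events_of J2 >> F ->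
  P (E `&` F) = (P E * P F)%E.
Proof.
move=> J12 /events_of_cylinders sE /events_of_cylinders sF.
have sub J : <<s cylinders_of J >> `<=` measurable.
  apply: smallest_sub; first exact: sigma_algebra_measurable.
  exact: cylinders_of_measurable.
have uniq_ext (J : set I) (m1 m2 : {measure set Omega -> \bar R}) :
    (m1 setT < +oo)%E ->
    (forall A, cylinders_of J A -> m1 A = m2 A) ->
    forall A, <<s cylinders_of J >> A -> m1 A = m2 A.
  move=> m1T m12; apply: (@g_sigma_algebra_measure_unique _ _ _
    (cylinders_of J) _ (fun=> setT)) => //.
  - exact: cylinders_of_measurable.
  - by move=> _; exact: cylinders_setT.
  - by apply/seteqP; split => // w _; exists 0%N.
  - exact: cylinders_of_setI.
have fin A : measurable A -> exists c : {nonneg R}, P A = c%:num%:E.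
  move=> mA; have f : P A \is a fin_num by rewrite fin_num_measure.
  have c0 : 0 <= fine (P A) by rewrite fine_ge0.
  by exists (NngNum c0); rewrite /= fineK.
have finI A B : measurable A -> measurable B -> (P (A `&` B) < +oo)%E.
  by move=> mA mB; rewrite -ge0_fin_numE// fin_num_measure//; exact: measurableI.
have step1 G : cylinders_of J1 G -> P (G `&` F) = (P G * P F)%E.
  move=> cG; have mG := cylinders_of_measurable cG.
  have [c Pc] := fin _ mG.
  rewrite setIC Pc -/(mrestr P mG F) -/(mscale c P F).
  apply: (uniq_ext J2) => //; first exact: finI.
  move=> A cA; change (P (A `&` G) = c%:num%:E * P A)%E; rewrite -Pc setIC.
  exact: (cylinders_independent J12).
have mF := sub _ _ sF; have [c Pc] := fin _ mF.
rewrite muleC Pc -/(mrestr P mF E) -/(mscale c P E).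
apply: (uniq_ext J1) => //; first exact: finI.
move=> A cA; change (P (A `&` F) = c%:num%:E * P A)%E.
by rewrite -Pc muleC; exact: step1.
Qed.

End blocks.

(** * Values of a trigonometric polynomial at a uniform angle *)

Section trigonometry.
Context {R : realType}.
Local Notation mu := (@lebesgue_measure R).
Implicit Types (x y t h : R).

Lemma ler_sqr_of_norm x c : `|x| <= c -> x ^+ 2 <= c ^+ 2.
Proof.
move=> xc; have c0 := le_trans (normr_ge0 x) xc.
by rewrite -real_normK ?num_real// lerXn2r.
Qed.

Lemma sin_increment x y : exists2 z, `|z| <= Num.max `|x| `|y| &
  sin x - sin y = cos z * (x - y).
Proof.
wlog xy : x y / y <= x => [hw|].
  have [|/ltW xy] := leP y x; first exact: hw.
  have [z hz e] := hw y x xy; exists z; first by rewrite maxC.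
  by rewrite -[LHS]opprB e -mulrN opprB.
have [|z zyx e] := @MVT_segment R sin cos y x xy (fun z _ => is_derive_sin z).
  exact/continuous_subspaceT/continuous_sin.
exists z => //; move: zyx; rewrite in_itv/= => /andP[yz zx].
rewrite le_max; have [z0|z0] := leP 0 z.
  by rewrite (ger0_norm z0) (ger0_norm (le_trans z0 zx)) zx.
by rewrite (ltr0_norm z0) (ltr0_norm (le_lt_trans yz z0)) lerN2 yz orbT.
Qed.

Lemma sin_lipschitz x y : `|sin x - sin y| <= `|x - y|.
Proof.
have [z _ ->] := sin_increment x y.
by rewrite normrM ler_piMl// cos_max.
Qed.

Lemma cos_lipschitz x y : `|cos x - cos y| <= `|x - y|.
Proof.
have := sin_lipschitz (x + pi / 2) (y + pi / 2).
by rewrite !sinDpihalf opprD addrACA subrr addr0.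
Qed.

Lemma norm_sin_le x : `|sin x| <= `|x|.
Proof. by have := sin_lipschitz x 0; rewrite sin0 !subr0. Qed.

Lemma one_minus_cos_le x : 1 - cos x <= x ^+ 2 / 2.
Proof.
have -> : x = (x / 2) *+ 2 by rewrite -mulr_natr divfK.
rewrite cos_mulr2n cos2sin2.
have : sin (x / 2) ^+ 2 <= (x / 2) ^+ 2.
  by rewrite -[leRHS]real_normK ?num_real//; exact/ler_sqr_of_norm/norm_sin_le.
by rewrite -(mulr_natr (x / 2)); set s := sin _ ^+ 2; lra.
Qed.

Lemma norm_sin_ge h : `|h| <= 4^-1 -> 31 / 32 * `|h| <= `|sin h|.
Proof.
move=> h4; have [z] := sin_increment h 0.
rewrite normr0 sin0 !subr0 (max_idPl _)// => zh ->; rewrite normrM ler_wpM2r//.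
apply: le_trans (ler_norm _).
have : z ^+ 2 <= (4^-1) ^+ 2.
  by apply: ler_sqr_of_norm; exact: le_trans h4.
by have := one_minus_cos_le z; lra.
Qed.

(** With [g = p cos + q sin], the sum of the squares of [g] and its derivative is
    [p ^+ 2 + q ^+ 2]. Where [g] is at most 23/20 in absolute value its
    derivative is therefore at least 4/5, and the addition formulas at [s] turn
    this into a lower bound for the increments of [g] over a distance 1/4. *)
Lemma anticoncentration_local (p q : R) s t :
  2 <= p ^+ 2 + q ^+ 2 ->
  `|p * cos s + q * sin s| <= 23 / 20 -> `|t - s| <= 4^-1 ->
  `|t - s| <= 2 * `|p * cos t + q * sin t - (p * cos s + q * sin s)|.
Proof.
move=> pq; set g := p * cos s + q * sin s => hg hts.
pose g' := q * cos s - p * sin s.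
have gg : g ^+ 2 + g' ^+ 2 = p ^+ 2 + q ^+ 2.
  rewrite -[RHS]mulr1 -(cos2Dsin2 s) /g /g'; ring.
have hg' : 4 / 5 <= `|g'|.
  suff : (4 / 5) ^+ 2 <= `|g'| ^+ 2 by rewrite ler_pXn2r ?nnegrE//; lra.
  rewrite real_normK ?num_real//.
  have : g ^+ 2 <= (23 / 20) ^+ 2.
    exact: ler_sqr_of_norm.
  by lra.
have -> : p * cos t + q * sin t - g = g' * sin (t - s) - g * (1 - cos (t - s)).
  have : t = s + (t - s) by ring.
  by move: (t - s) => h ->; rewrite cosD sinD /g /g'; ring.
have h1 := norm_sin_ge hts; have h2 := one_minus_cos_le (t - s).
have h3 : `|g * (1 - cos (t - s))| <= 23 / 20 * (`|t - s| / 8).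
  rewrite normrM ler_pM//.
  rewrite ger0_norm; last by rewrite subr_ge0 cos_le1.
  apply: (le_trans h2); rewrite -real_normK ?num_real// expr2.
  have : `|t - s| * `|t - s| <= `|t - s| * 4^-1 by rewrite ler_wpM2l.
  by lra.
have h4 : 4 / 5 * (31 / 32 * `|t - s|) <= `|g' * sin (t - s)|.
  by rewrite normrM ler_pM//; lra.
have := lerB_dist (g' * sin (t - s)) (g * (1 - cos (t - s))).
by have := normr_ge0 (t - s); lra.
Qed.

(** The probability that two discs stay in contact in projection. The interval
    [0, 2 pi] is cut into pieces of length 1/4; on each piece the event forces
    the function to vary by at most [4 * delta / a], so by the local estimate it
    lives in an interval of length [8 * (delta / a)]. *)
Lemma anticoncentration (p q a z delta : R) :
  0 < a -> 0 <= delta -> 2 <= p ^+ 2 + q ^+ 2 -> `|z| <= a ->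
  delta <= 3 / 40 * a ->
  (mu ([set t | (`|a * (p * cos t + q * sin t) + z| <= 2 * delta)%R] `&` `[0%R, (2 * pi)%R])
     <= (256 * (delta / a))%:E)%E.
Proof.
move=> a0 d0 pq za da; set E := [set t | _].
pose F k := E `&` `[k%:R / 4, k.+1%:R / 4]%classic.
have muF k : (mu (F k) <= (8 * (delta / a))%:E)%E.
  apply: lebesgue_measure_le_diameter.
    by rewrite mulr_ge0// divr_ge0// ltW.
  move=> t s [/= Et +] [/= Es +].
  have kS : k.+1%:R = k%:R + 1 :> R by rewrite natr1.
  rewrite !in_itv/= kS => /andP[t1 t2] /andP[s1 s2].
  move: Et Es; rewrite /E/=.
  set gt := p * cos t + q * sin t; set gs := p * cos s + q * sin s => Et Es.
  have bd g : `|a * g + z| <= 2 * delta -> a * `|g| <= a * (23 / 20).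
    move=> h; have <- : `|a * g| = a * `|g| by rewrite normrM gtr0_norm.
    by have := lerB_normD (a * g) z; lra.
  have hs : `|gs| <= 23 / 20 by rewrite -(ler_pM2l a0); exact: bd.
  have := @anticoncentration_local p q s t pq hs.
  rewrite -/gt -/gs => hl; apply: (le_trans (hl _)).
    by rewrite ler_norml; apply/andP; split; lra.
  (* both values lie within [2 * delta] of [- z] *)
  have : a * `|gt - gs| <= 4 * delta.
    have <- : `|a * (gt - gs)| = a * `|gt - gs| by rewrite normrM gtr0_norm.
    rewrite (_ : a * (gt - gs) = (a * gt + z) - (a * gs + z)); last by ring.
    by apply: (le_trans (ler_normB _ _)); lra.
  by rewrite -ler_pdivlMl// mulrC => h; lra.
have muU n : (mu (\big[setU/set0]_(k < n) F k) <= (n%:R * (8 * (delta / a)))%:E)%E.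
  elim: n => [|n IHn]; first by rewrite big_ord0 measure0 mul0r.
  rewrite big_ord_recr/=; apply: (le_trans (lebesgue_measureU _ _)).
  by rewrite -natr1 mulrDl mul1r EFinD; exact: leeD.
apply: (@le_trans _ _ (mu (\big[setU/set0]_(k < 32) F k))); last first.
  by apply: (le_trans (muU 32)); rewrite lee_fin; lra.
apply: le_lebesgue_measure => t [Et]; rewrite /= in_itv/= => /andP[t0 t2].
have t8 : t < 8 by have := @pihalf_lt2 R; lra.
pose k := Num.truncn (4 * t).
have /andP[k1 k2] : k%:R <= 4 * t < k.+1%:R by apply: truncn_itv; lra.
have k32 : (k < 32)%N by rewrite -(ltr_nat R); lra.
have kS : k.+1%:R = k%:R + 1 :> R by rewrite natr1.
rewrite -bigcup_mkord; exists k => //; split => //=.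
by rewrite in_itv/=; apply/andP; split; lra.
Qed.

(** The map [t |-> x + a * cos (t - theta)] is [a]-Lipschitz, and takes on
    [0, 2 pi] every value within [a] of [x] when [theta] lies in [0, pi]. *)
Lemma spread (a x theta : R) (B : set R) :
  0 < a -> 0 <= theta <= pi -> (forall b, B b -> `|b - x| <= a) ->
  (mu B <= a%:E * mu ([set t | B (x + a * cos (t - theta))%R] `&` `[0%R, (2 * pi)%R]))%E.
Proof.
move=> a0 /andP[th0 thpi] Bx.
apply: le_trans (lebesgue_measure_lipschitz_image
  (g := fun t => x + a * cos (t - theta)) a0 _); last first.
  move=> s t _ _; rewrite opprD addrACA subrr add0r -mulrBr normrM gtr0_norm//.
  rewrite ler_pM2l//; apply: (le_trans (cos_lipschitz _ _)).
  by rewrite opprB addrA subrK.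
apply: le_lebesgue_measure => b Bb.
have hc : -1 <= (b - x) / a <= 1.
  by rewrite -ler_norml normrM normfV (gtr0_norm a0) ler_pdivrMr// mul1r Bx.
exists (acos ((b - x) / a) + theta).
  split => /=.
    by rewrite addrK acosK ?in_itv//= mulrC divfK ?gt_eqF// addrC subrK.
  rewrite in_itv/=; have := acos_ge0 hc; have := acos_lepi hc.
  by move=> ? ?; apply/andP; split; lra.
by rewrite addrK acosK ?in_itv//= mulrC divfK ?gt_eqF// addrC subrK.
Qed.

Lemma uniform_probE (A : set R) : measurable A ->
  uniform_prob (@two_pi_gt0 R) A = ((2 * pi)^-1%:E * mu (A `&` `[0%R, (2 * pi)%R]))%E.
Proof.
move=> mA.
have <- : (\int[uniform_prob (@two_pi_gt0 R)]_x (\1_A x)%:E)%E =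
    uniform_prob (@two_pi_gt0 R) A.
  by rewrite integral_indic ?setIT; [by []|exact: measurableT|exact: mA].
rewrite integral_uniform//; last first.
  by apply/measurable_EFinP; exact: measurable_indic.
by rewrite subr0 integral_indic;
  [by []|exact: measurable_itv|exact: mA].
Qed.

End trigonometry.

(** * Projected centres along the tree of words *)

Section words.

Fixpoint words (m : nat) : seq word :=
  if m is m'.+1 then [seq rcons u j | j <- enum 'I_4, u <- words m'] else [:: [::]].

Lemma mem_words m (u : word) : (u \in words m) = (size u == m).
Proof.
elim: m u => [|m IHm] u /=; first by rewrite inE size_eq0.
apply/allpairsP/eqP => [[[j v] [_ /= vm ->]]|].
  by rewrite size_rcons; congr _.+1; apply/eqP; rewrite -IHm.
case/lastP: u => [//|v j]; rewrite size_rcons => -[vm].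
by exists (j, v); split => //=; rewrite ?mem_enum// IHm vm.
Qed.

Lemma size_words m : size (words m) = (4 ^ m)%N.
Proof. by elim: m => //= m IHm; rewrite size_allpairs IHm size_enum_ord expnS. Qed.

Lemma big_wordsS (V : nmodType) m (F : word -> V) :
  \sum_(u <- words m.+1) F u = \sum_(j < 4) \sum_(u <- words m) F (rcons u j).
Proof. by rewrite /= big_allpairs_dep big_enum. Qed.

Lemma cover_words_rcons (R : realType) m (y : word -> R) delta x :
  interval_cover (words m.+1) y delta x <->
  exists j : 'I_4, interval_cover (words m) (fun u => y (rcons u j)) delta x.
Proof.
rewrite /interval_cover /=; split.
  move=> /hasP[_ /allpairsP[[j u] [_ um ->]] h]; exists j.
  by apply/hasP; exists u.
move=> [j /hasP[u um h]]; apply/hasP; exists (rcons u j) => //.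
by apply/allpairsP; exists (j, u); rewrite mem_enum.
Qed.

End words.

Section projected_tree.
Context {R : realType}.
Variable r : nat -> R.
Implicit Types (omega : word -> R) (theta : R) (i u : word).

Definition displacement omega theta i (j : 'I_4) : R :=
  (r (size i) - r (size i).+1) * cos (omega i + 2 * pi * j%:R / 4 - theta).

(** Projection of the centre of the disc of the word i u relative to that of i.
    It depends only on the angles at and below i, which is what makes the
    subtrees below distinct children independent of the angle at i. *)
Fixpoint offset omega theta i u : R :=
  if u is j :: u' then offset omega theta i u' + displacement omega theta (u' ++ i) j
  else 0.

(** The recursion of [offset] peels off the last letter of a word; the bounds
    are recursions on the first one. *)
Lemma offset_rcons omega theta i u j :
  offset omega theta i (rcons u j) =
  displacement omega theta i j + offset omega theta (j :: i) u.
Proof.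
elim: u => [|k u IHu] /=; first by rewrite addrC.
by rewrite IHu -addrA cat_rcons.
Qed.

Lemma line_proj_disc_center omega theta u :
  line_proj theta (disc_center r omega u) = offset omega theta [::] u.
Proof.
elim: u => [|j u IHu] /=; first by rewrite /line_proj !mul0r addr0.
rewrite -IHu cats0 /line_proj /= /displacement cosB /GRing.scale/=.
by ring.
Qed.

Lemma offset_bound omega theta i u : (forall n, r n.+1 <= r n) ->
  `|offset omega theta i u| <= r (size i) - r (size u + size i)%N.
Proof.
move=> rS; elim: u => [|j u IHu] /=; first by rewrite normr0 subrr.
apply: (le_trans (ler_normD _ _)).
have : `|displacement omega theta (u ++ i) j| <=
    r (size u + size i)%N - r (size u + size i).+1.
  rewrite /displacement size_cat normrM ger0_norm ?subr_ge0// ler_piMr ?subr_ge0//.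
  exact: cos_max.
by rewrite addSn; lra.
Qed.

Lemma measurable_displacement d (T : measurableType d) (om : word -> T -> R)
    (th : T -> R) i j :
  measurable_fun setT (om i) -> measurable_fun setT th ->
  measurable_fun setT (fun w => displacement (om ^~ w) (th w) i j).
Proof.
move=> mo mt; rewrite /displacement; apply: measurable_funM => //.
apply: measurableT_comp; first exact: continuous_measurable_fun (@continuous_cos R).
by apply: measurable_funB => //; apply: measurable_funD.
Qed.

Lemma measurable_offset d (T : measurableType d) (om : word -> T -> R)
    (th : T -> R) i u :
  (forall v, measurable_fun setT (om (v ++ i))) -> measurable_fun setT th ->
  measurable_fun setT (fun w => offset (om ^~ w) (th w) i u).
Proof.
move=> mo mt; elim: u => [|j u IHu] /=; first exact: measurable_cst.
by apply: measurable_funD => //; exact: measurable_displacement.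
Qed.

(** The unit vectors at angles differing by a nonzero multiple of a quarter turn
    are at distance at least [Num.sqrt 2]; [p] and [q] are, up to signs, the
    coordinates of the difference of these vectors rotated by [- theta]. *)
Lemma displacementB theta i (j l : 'I_4) : j != l ->
  exists p q : R, 2 <= p ^+ 2 + q ^+ 2 /\
   forall t, (r (size i) - r (size i).+1) * cos (t + 2 * pi * j%:R / 4 - theta) -
             (r (size i) - r (size i).+1) * cos (t + 2 * pi * l%:R / 4 - theta) =
             (r (size i) - r (size i).+1) * (p * cos t + q * sin t).
Proof.
move=> jl; pose c (j : 'I_4) : R := 2 * pi * j%:R / 4 - theta.
exists (cos (c j) - cos (c l)), (sin (c l) - sin (c j)); split; last first.
  by move=> t; rewrite -mulrBr -!addrA -!/(c _) !cosD; ring.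
have : cos (c j - c l) <= 0.
  rewrite (_ : c j - c l = (j%:R - l%:R) * (pi / 2)); last by rewrite /c; field.
  clear c; wlog lj : j l jl / (l < j)%N => [hw|].
    have [lj|jl'] := ltnP l j; first exact: hw.
    rewrite -cosN -mulNr opprB; apply: hw; first by rewrite eq_sym.
    by rewrite ltn_neqAle jl'; move: jl; rewrite -val_eqE => ->.
  rewrite -natrB 1?ltnW//.
  have : (0 < j - l)%N by rewrite subn_gt0.
  have : (j - l < 4)%N by rewrite (leq_ltn_trans (leq_subr _ _)).
  case: (j - l)%N => [//|[|[|[|//]]]] _ _.
  - by rewrite mul1r cos_pihalf.
  - by rewrite mulrC divfK// cospi lerN10.
  - by rewrite (_ : 3%:R * (pi / 2) = pi + pi / 2 :> R) ?cosDpihalf ?sinpi ?oppr0//; field.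
rewrite cosB; have := cos2Dsin2 (c j); have := cos2Dsin2 (c l).
by move=> *; lra.
Qed.

End projected_tree.

(** * Mean overlap of two sets in random relative position *)

Section overlap.
Context {R : realType}.
Local Notation mu := (@lebesgue_measure R).
Local Notation unif := (uniform_prob (@two_pi_gt0 R)).
Local Open Scope ereal_scope.

Lemma eq_indic_iff (T T' : Type) (A : set T) (B : set T') x y :
  (A x <-> B y) -> \1_A x = \1_B y :> R.
Proof.
move=> AB; rewrite !indicE; suff -> : (x \in A) = (y \in B) by [].
by apply/idP/idP; rewrite !inE => /AB.
Qed.

Lemma measurable_fun_interval_coverI d (T : measurableType d) (I : Type)
    (y z : I -> T -> R) (s : seq I) (delta : R) :
  (forall u, measurable_fun setT (y u)) -> (forall u, measurable_fun setT (z u)) ->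
  measurable_fun setT (fun t => mu (interval_cover s (y ^~ t) delta `&`
                                    interval_cover s (z ^~ t) delta)).
Proof.
move=> my mz.
have := @measurable_fun_xsection _ _ _ _ _ mu _ (measurableI _ _
  (measurable_interval_cover_joint my s delta) (measurable_interval_cover_joint mz s delta)).
apply: eq_measurable_fun => t _ /=; congr (mu _).
by apply/seteqP; split=> x; rewrite /xsection/= inE.
Qed.

(** By Tonelli the left-hand side is an integral over [B0] of the probability
    that a point displaced by [2 * a * cos (t - theta)] falls into [B2], and
    this probability is at least proportional to the length of [B2] because
    the displacement covers all of [-2a, 2a] at speed at most [2 * a]. *)
Lemma mean_overlap_ge (a theta : R) (B0 B2 : set R) :
  (0 < a)%R -> (0 <= theta <= pi)%R -> measurable B0 -> measurable B2 ->
  (forall x b, B0 x -> B2 b -> `|b - x| <= 2 * a)%R ->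
  (4 * pi * a)^-1%:E * (mu B0 * mu B2) <=
  \int[unif]_t mu (B0 `&` [set x | B2 (x + 2 * a * cos (t - theta))%R]).
Proof.
move=> a0 hth mB0 mB2 hB.
pose S := [set p : R * R | B0 p.2 /\ B2 (p.2 + 2 * a * cos (p.1 - theta))%R].
have mS : measurable S.
  have m1 : measurable_fun setT (fun p : R * R => p.2) by exact: measurable_snd.
  have m2 : measurable_fun setT (fun p : R * R => p.2 + 2 * a * cos (p.1 - theta))%R.
    apply: measurable_funD => //; apply: measurable_funM => //.
    apply: measurableT_comp; first exact: continuous_measurable_fun (@continuous_cos R).
    by apply: measurable_funB => //; exact: measurable_fst.
  rewrite (_ : S = (setT `&` (fun p : R * R => p.2) @^-1` B0) `&`
    (setT `&` (fun p : R * R => p.2 + 2 * a * cos (p.1 - theta))%R @^-1` B2)).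
    by apply: measurableI; [exact: m1|exact: m2].
  by rewrite !setTI.
have mf : measurable_fun setT (fun p : R * R => (\1_S p)%:E : \bar R).
  by apply/measurable_EFinP; exact: measurable_indic.
have -> : \int[unif]_t mu (B0 `&` [set x | B2 (x + 2 * a * cos (t - theta))%R]) =
    \int[unif]_t \int[mu]_x (\1_S (t, x))%:E.
  apply: eq_integral => t _.
  have -> : (fun x : R => (\1_S (t, x))%:E : \bar R) =
    (fun x => (\1_(B0 `&` [set x | B2 (x + 2 * a * cos (t - theta))%R]) x)%:E).
    by apply/funext => x; congr (_%:E); apply: eq_indic_iff.
  rewrite integral_indic ?setIT//.
  have := measurable_xsection t mS.
  by congr measurable; apply/seteqP; split=> x; rewrite /xsection/= inE.
have -> : \int[unif]_t \int[mu]_x (\1_S (t, x))%:E =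
    \int[mu]_x \int[unif]_t (\1_S (t, x))%:E.
  apply: (fubini_tonelli (m1 := unif) (m2 := mu)
    (fun p : R * R => (\1_S p)%:E)) => //.
have -> : (4 * pi * a)^-1%:E * (mu B0 * mu B2) =
    \int[mu]_x (((4 * pi * a)^-1%:E * mu B2) * (\1_B0 x)%:E).
  have mI : measurable_fun setT (fun x : R => (\1_B0 x)%:E : \bar R).
    by apply/measurable_EFinP; exact: measurable_indic.
  have k0 : 0 <= (4 * pi * a)^-1%:E * mu B2.
    by rewrite mule_ge0// lee_fin invr_ge0 !mulr_ge0 ?pi_ge0// ltW.
  rewrite ge0_integralZl;
    [|exact: measurableT|exact: mI|by move=> x _; rewrite lee_fin|exact: k0].
  rewrite integral_indic ?setIT; [|exact: measurableT|exact: mB0].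
  by rewrite [in LHS](muleC (mu B0)) muleA.
apply: ge0_le_integral_lower => x _.
  rewrite mule_ge0 ?lee_fin// mule_ge0// lee_fin invr_ge0 !mulr_ge0 ?pi_ge0//.
  exact: ltW.
have [xB0|xB0] := boolP (x \in B0); last first.
  by rewrite indicE (negbTE xB0) mule0; apply: integral_ge0 => t _; rewrite lee_fin.
rewrite indicE xB0 mule1; move: xB0; rewrite inE => xB0.
pose A := [set t | B2 (x + 2 * a * cos (t - theta))%R].
have mA : measurable A.
  have := measurable_ysection x mS.
  congr measurable; apply/seteqP; split=> t; rewrite /ysection/= inE /S/A/=.
    by case.
  by split.
have -> : \int[unif]_t (\1_S (t, x))%:E = \int[unif]_t (\1_A t)%:E.
  apply: eq_integral => t _; congr (_%:E); apply: eq_indic_iff.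
  by split; [case|split].
have -> : \int[unif]_t (\1_A t)%:E =
    (2 * pi)^-1%:E * mu (A `&` `[0%R, (2 * pi)%R]).
  by rewrite integral_indic ?setIT;
    [exact: uniform_probE|exact: measurableT|exact: mA].
have a20 : (0 < 2 * a)%R by rewrite mulr_gt0.
have := spread a20 hth (fun b Bb => hB x b xB0 Bb).
rewrite -/A => h.
have -> : (4 * pi * a)^-1%:E = (2 * pi)^-1%:E * (2 * a)^-1%:E :> \bar R.
  by rewrite -EFinM -invfM; congr (_^-1%:E); ring.
rewrite -muleA; apply: lee_wpmul2l.
  by rewrite lee_fin invr_ge0 mulr_ge0// pi_ge0.
rewrite muleC lee_pdivrMr// muleC.
exact: h.
Qed.

End overlap.

(** * One generation of the random tree *)

Section random_tree.
Context d (Omega : measurableType d) (R : realType) (P : probability Omega R).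
Context (I : eqType) (X : I -> {RV P >-> R}) (phi : word -> I).
Variables (r : nat -> R) (theta delta : R).
Hypothesis X_iid : iid_uniform_angles X.
Hypothesis phi_fresh : forall i v j, phi (v ++ j :: i) != phi i.
Hypothesis r_decr : forall n, r n.+1 <= r n.
Hypothesis theta_pi : 0 <= theta <= pi.
Hypothesis delta_gt0 : 0 < delta.
Local Notation mu := (@lebesgue_measure R).
Local Notation unif := (uniform_prob (@two_pi_gt0 R)).

Definition angle (i : word) : Omega -> R := X (phi i).

Definition below (i : word) : set I := [set k | exists v j, k = phi (v ++ j :: i)].

(* the events decided by the angles strictly below [i] *)
Local Notation descendants i := (g_sigma_algebraType (events_of X (below i))).

Lemma measurable_angle i : measurable_fun setT (angle i).
Proof. exact: measurable_funP. Qed.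

Lemma measurable_angle_below i v j :
  measurable_fun setT (angle (v ++ j :: i) : descendants i -> R).
Proof.
move=> _ A mA; rewrite setTI; apply: sub_sigma_algebra.
by exists (phi (v ++ j :: i)), A; split => //; exists v, j.
Qed.

Lemma measurable_offset_below i j u :
  measurable_fun setT
    (fun w : descendants i => offset r (fun v => angle v w) theta (j :: i) u).
Proof.
apply: (@measurable_offset _ _ _ (descendants i) angle (fun=> theta)) => //.
by move=> v; exact: measurable_angle_below.
Qed.

Local Open Scope ereal_scope.

(** The angle at [i] is uniform and independent of the angles strictly below
    [i], so it can be averaged out with all subtrees of [i] held fixed. *)
Lemma ge0_integral_root i (F : (R * descendants i)%type -> \bar R) :
  measurable_fun setT F -> (forall z, 0 <= F z) ->
  \int[P]_w F (angle i w, w) = \int[P]_w \int[unif]_t F (t, w).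
Proof.
move=> mF F0.
have mid : measurable_fun setT (idfun : Omega -> descendants i).
  move=> _ A mA; rewrite setTI preimage_id.
  move: A mA; apply: smallest_sub; first exact: sigma_algebra_measurable.
  exact: (@events_of_measurable _ _ _ P _ X (below i)).
pose XR : Omega -> measurableTypeR R := angle i.
have mX : measurable_fun setT XR by exact: measurable_angle.
have indep A B : measurable A -> measurable B ->
    P (XR @^-1` A `&` (idfun : Omega -> descendants i) @^-1` B) =
    P (XR @^-1` A) * P ((idfun : Omega -> descendants i) @^-1` B).
  move=> mA mB; rewrite preimage_id.
  apply: (@sigma_blocks_independent _ _ _ _ _ X X_iid.1 [set phi i] (below i)) => //.
    apply/seteqP; split => // k /= [-> [v [j /eqP]]].
    by rewrite eq_sym (negbTE (phi_fresh _ _ _)).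
  by apply: sub_sigma_algebra; exists (phi i), A.
pose F' : (measurableTypeR R * descendants i)%type -> \bar R := F.
have mF' : measurable_fun setT F' by exact: mF.
rewrite [LHS](ge0_integral_independent_pair mX mid indep mF' F0).
apply: eq_integral => w _.
pose X' : {mfun Omega >-> measurableTypeR R} := mfun_Sub (mem_set mX).
have mFw : measurable_fun setT (fun t => F' (t, w)).
  by apply: (measurableT_comp mF'); exact: pair2_measurable.
rewrite -[LHS](@ge0_integral_distribution _ _ _ _ _ P X' (fun t => F' (t, w)))//.
by apply: eq_measure_integral => A mA _; exact: X_iid.2.
Qed.

(** Length of the projection, in the direction [theta], of the discs of radius
    [delta] around the centres [m] levels below [i], up to a translation. *)
Definition shadow i m (w : Omega) : \bar R :=
  mu (interval_cover (words m) (offset r (fun v => angle v w) theta i) delta).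

Lemma measurable_shadow i m : measurable_fun setT (shadow i m).
Proof.
apply: (@measurable_fun_interval_cover _ _ _ _
  (fun u w => offset r (fun v => angle v w) theta i u)) => u.
by apply: (@measurable_offset _ _ _ _ angle (fun=> theta)).
Qed.

Lemma shadow_ge0 i m w : 0 <= shadow i m w.
Proof. exact: measure_ge0. Qed.

Lemma lebesgue_measure_setU4 (A0 A1 A2 A3 : set R) : measurable A0 -> measurable A2 ->
  mu (A0 `|` A1 `|` A2 `|` A3) + mu (A0 `&` A2) <= mu A0 + mu A1 + mu A2 + mu A3.
Proof.
move=> mA0 mA2.
rewrite (_ : A0 `|` A1 `|` A2 `|` A3 = (A0 `|` A2) `|` (A1 `|` A3)); last first.
  by apply/seteqP; split => x /=; tauto.
apply: (le_trans (leeD2r _ (lebesgue_measureU _ _))).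
rewrite addeAC (_ : mu (A0 `|` A2) + mu (A0 `&` A2) = mu A0 + mu A2); last first.
  rewrite (measureDI mu mA2 mA0) (setIC A2) addeA; congr (_ + _).
  rewrite -measureU//; last 2 first.
  - exact: measurableD.
  - by apply/seteqP; split => // x /= [? []].
  congr (mu _); apply/seteqP; split => x /=.
    by have [?|?] := pselect (A0 x); tauto.
  by tauto.
apply: (le_trans (leeD2l _ (lebesgue_measureU _ _))).
by rewrite addeACA !addeA.
Qed.

Definition letter (j : nat) (j4 : (j < 4)%N) : 'I_4 := Ordinal j4.

Lemma big_letters (V : nmodType) (F : 'I_4 -> V) :
  (\sum_(j < 4) F j = F (@letter 0 isT) + F (@letter 1 isT) + F (@letter 2 isT)
     + F (@letter 3 isT))%R.
Proof.
rewrite !big_ord_recl big_ord0 addr0 !addrA.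
by congr (F _ + F _ + F _ + F _)%R; apply: val_inj.
Qed.

(** The four subtrees contribute at most the sum of their lengths, minus the
    overlap of the children 0 and 2. These are displaced in opposite
    directions, hence by [2 * a * cos (t - theta)] relative to each other, and
    the second hypothesis confines each of their shadows to [-a, a]. *)
Lemma mean_shadow_step i m (a := (r (size i) - r (size i).+1)%R) :
  (0 < a)%R -> (r (size i).+1 - r (m + (size i).+1)%N + delta <= a)%R ->
  \int[P]_w shadow i m.+1 w +
    (4 * pi * a)^-1%:E * \int[P]_w (shadow (@letter 0 isT :: i) m w *
                                    shadow (@letter 2 isT :: i) m w) <=
  \sum_(j < 4) \int[P]_w shadow (j :: i) m w.
Proof.
move=> a0 ha.
pose y (j : 'I_4) u w := offset r (fun v => angle v w) theta (j :: i) u.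
pose disp (j : 'I_4) t := (a * cos (t + 2 * pi * j%:R / 4 - theta))%R.
pose A (j : 'I_4) t w := interval_cover (words m) (fun u => y j u w + disp j t)%R delta.
have shA j w t : mu (A j t w) = shadow (j :: i) m w.
  exact: lebesgue_measure_cover_shift.
have mA j t w : measurable (A j t w) by exact: measurable_interval_cover.
set o0 := @letter 0 isT; set o2 := @letter 2 isT.
pose F (p : R * descendants i) := mu (A o0 p.1 p.2 `&` A o2 p.1 p.2).
have mF : measurable_fun setT F.
  have my (j : 'I_4) u : measurable_fun setT
      (fun p : (R * descendants i)%type => y j u p.2 + disp j p.1)%R.
    apply: measurable_funD.
      have m2 : measurable_fun setT (snd : (R * descendants i)%type -> descendants i).
        exact: measurable_snd.
exact: (measurableT_comp (@measurable_offset_below i j u) m2).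
    apply: measurable_funM => //.
    apply: measurableT_comp; first exact: continuous_measurable_fun (@continuous_cos R).
    by apply: measurable_funB => //; apply: measurable_funD.
  exact: (measurable_fun_interval_coverI (words m) delta (my o0) (my o2)).
have F0 p : 0 <= F p by exact: measure_ge0.
have mFw : measurable_fun setT (fun w => F (angle i w, w)).
  have my (j : 'I_4) u : measurable_fun setT
      (fun w : Omega => y j u w + disp j (angle i w))%R.
    apply: measurable_funD.
      by apply: (@measurable_offset _ _ _ _ angle (fun=> theta)).
    apply: measurable_funM => //.
    apply: measurableT_comp; first exact: continuous_measurable_fun (@continuous_cos R).
    by apply: measurable_funB => //; apply: measurable_funD.
  exact: (measurable_fun_interval_coverI (words m) delta (my o0) (my o2)).
apply: (@le_trans _ _ (\int[P]_w (shadow i m.+1 w + F (angle i w, w)))).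
  rewrite ge0_integralD//; last exact: measurable_shadow.
  apply: leeD2l; rewrite ge0_integral_root//.
  rewrite -ge0_integralZl//; last 3 first.
  - by apply: emeasurable_funM; exact: measurable_shadow.
  - by move=> w _; rewrite mule_ge0.
  - by rewrite lee_fin invr_ge0 !mulr_ge0 ?pi_ge0// ltW.
  apply: ge0_le_integral_lower => w _.
    by rewrite mule_ge0 ?mule_ge0// lee_fin invr_ge0 !mulr_ge0 ?pi_ge0// ltW.
  pose B (j : 'I_4) := interval_cover (words m) (fun u => y j u w) delta.
  have B_bound j x : B j x -> (`|x| <= a)%R.
    move=> /hasP[u]; rewrite mem_words => /eqP um xu.
    have := @offset_bound _ r (fun v => angle v w) theta (j :: i) u r_decr.
    rewrite um -/(y j u w) /= => yu; have := ler_normD (x - y j u w)%R (y j u w).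
    by rewrite subrK; lra.
  have cos_o0 t : disp o0 t = (a * cos (t - theta))%R.
    by rewrite /disp /= mulr0 mul0r addr0.
  have cos_o2 t : disp o2 t = (- (a * cos (t - theta)))%R.
    rewrite /disp (_ : t + _ - theta = t - theta + pi)%R ?cosDpi ?mulrN//=.
    by field.
  have FE t : F (t, w) =
      mu (B o0 `&` [set x | B o2 (x + 2 * a * cos (t - theta))%R]).
    rewrite -[RHS](lebesgue_measure_translate _ (a * cos (t - theta))%R).
    rewrite /F /A /= !interval_cover_shift cos_o0 cos_o2.
    congr (mu _); apply/seteqP; split => x /= [h1 h2]; split => //;
      by move: h2; rewrite opprK; congr (B o2 _); ring.
  under [leRHS]eq_integral do rewrite FE.
  apply: mean_overlap_ge => //.
  - exact: measurable_interval_cover.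
  - exact: measurable_interval_cover.
  - move=> x b /B_bound hx /B_bound hb.
    by apply: (le_trans (ler_normB _ _)); lra.
rewrite -ge0_integral_sum//; last by move=> j; exact: measurable_shadow.
apply: ge0_le_integral_lower => w _; first by rewrite adde_ge0.
rewrite big_letters -!(shA _ w (angle i w)).
apply: (le_trans _ (lebesgue_measure_setU4 _ _ _ _)) => //.
apply: leeD2r; apply: le_lebesgue_measure => x /cover_words_rcons [j hj].
have {hj} : A j (angle i w) w x.
  rewrite /A (_ : (fun u => _) =
    (fun u => offset r (fun v => angle v w) theta i (rcons u j)))//.
  by apply/funext => u; rewrite offset_rcons addrC.
case: j => -[|[|[|[|//]]]] h; rewrite /= (bool_irrelevance h isT) => ?; tauto.
Qed.

Lemma measurable_close i u v :
  measurable [set w | `|offset r (fun k => angle k w) theta i u -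
                        offset r (fun k => angle k w) theta i v| <= 2 * delta]%R.
Proof.
rewrite -[X in measurable X]setTI.
have mo x : measurable_fun setT (fun w => offset r (fun k => angle k w) theta i x).
  by apply: (@measurable_offset _ _ _ _ angle (fun=> theta)).
have mf : measurable_fun setT (fun w => `|offset r (fun k => angle k w) theta i u -
                        offset r (fun k => angle k w) theta i v|%R).
  by apply: measurableT_comp => //; apply: measurable_funB.
have := mf measurableT _ (measurable_itv `]-oo, (2 * delta)%R]).
by congr measurable; apply/seteqP; split => w [_]; rewrite /= in_itv.
Qed.

(** The mean number of pairs of intervals of radius [delta] that meet. *)
Definition close_pairs i m : \bar R := \sum_(u <- words m) \sum_(v <- words m)
  P [set w | `|offset r (fun k => angle k w) theta i u -
               offset r (fun k => angle k w) theta i v| <= 2 * delta]%R.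

(** Two words that part at [i] are displaced by [a * (p cos t + q sin t)], where
    [t] is the angle at [i], plus a difference of offsets inside the two
    subtrees. The latter is independent of [t] and at most [a]: this is where
    the contraction ratio 1/3 enters. *)
Lemma prob_close_le i m u v (j l : 'I_4) (a := (r (size i) - r (size i).+1)%R) :
  j != l -> u \in words m -> v \in words m ->
  (0 < a)%R -> (2 * (r (size i).+1 - r (m + (size i).+1)%N) <= a)%R ->
  (delta <= 3 / 40 * a)%R ->
  P [set w | `|offset r (fun k => angle k w) theta i (rcons u j) -
               offset r (fun k => angle k w) theta i (rcons v l)| <= 2 * delta]%R
  <= (64 * (delta / a))%:E.
Proof.
move=> jl um vm a0 ha da.
pose y (j : 'I_4) u w := offset r (fun v => angle v w) theta (j :: i) u.
have [p [q [pq dispB]]] := displacementB r theta i jl.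
pose S := [set z : R * descendants i |
  `|a * (p * cos z.1 + q * sin z.1) + (y j u z.2 - y l v z.2)| <= 2 * delta]%R.
have mS : measurable S.
  rewrite -[X in measurable X]setTI.
  have m2 : measurable_fun setT (snd : (R * descendants i)%type -> descendants i).
    exact: measurable_snd.
  have mf : measurable_fun setT (fun z : (R * descendants i)%type =>
     `|a * (p * cos z.1 + q * sin z.1) + (y j u z.2 - y l v z.2)|)%R.
    apply: measurableT_comp => //; apply: measurable_funD.
      apply: measurable_funM => //; apply: measurable_funD.
        apply: measurable_funM => //; apply: measurableT_comp => //.
        exact: continuous_measurable_fun (@continuous_cos R).
      apply: measurable_funM => //; apply: measurableT_comp => //.
      exact: continuous_measurable_fun (@continuous_sin R).
    apply: measurable_funB.
      exact: (measurableT_comp (@measurable_offset_below i j u) m2).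
    exact: (measurableT_comp (@measurable_offset_below i l v) m2).
  have := mf measurableT _ (measurable_itv `]-oo, (2 * delta)%R]).
  by congr measurable; apply/seteqP; split => w [_]; rewrite /= in_itv.
have mF : measurable_fun setT (fun z : (R * descendants i)%type => (\1_S z)%:E : \bar R).
  by apply/measurable_EFinP; exact: measurable_indic.
have -> : P [set w | `|offset r (fun k => angle k w) theta i (rcons u j) -
               offset r (fun k => angle k w) theta i (rcons v l)| <= 2 * delta]%R
    = \int[P]_w (\1_S (angle i w, w))%:E.
  rewrite -[X in P X]setIT -integral_indic//; last exact: measurable_close.
  apply: eq_integral => w _; congr (_%:E); apply: eq_indic_iff => /=.
  rewrite !offset_rcons opprD addrACA.
  by rewrite /S /= -dispB.
rewrite (ge0_integral_root mF); last by move=> z; rewrite lee_fin.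
rewrite -[leRHS]mule1 -(probability_setT P) -integral_cst//.
apply: ge0_le_integral_lower => w _.
  by apply: integral_ge0 => t _; rewrite lee_fin.
pose Sw : set R :=
  [set t | `|a * (p * cos t + q * sin t) + (y j u w - y l v w)| <= 2 * delta]%R.
have mSw : measurable Sw.
  have := measurable_ysection (w : descendants i) mS; congr measurable.
  by apply/seteqP; split => t; rewrite /ysection/= inE.
have -> : \int[unif]_t (\1_S (t, w))%:E = (2 * pi)^-1%:E * mu (Sw `&` `[0%R, (2 * pi)%R]).
  transitivity (\int[unif]_t (\1_Sw t)%:E).
    by apply: eq_integral => t _; congr (_%:E); apply: eq_indic_iff.
  by rewrite integral_indic ?setIT;
    [exact: uniform_probE|exact: measurableT|exact: mSw].
have pi2 := @pi_ge2 R.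
have zle : (`|y j u w - y l v w| <= a)%R.
  move: um vm; rewrite !mem_words => /eqP um /eqP vm.
  have := @offset_bound _ r (fun v => angle v w) theta (j :: i) u r_decr.
  have := @offset_bound _ r (fun v => angle v w) theta (l :: i) v r_decr.
  rewrite um vm -/(y j u w) -/(y l v w) /= => hv hu.
  by apply: (le_trans (ler_normB _ _)); lra.
apply: (@le_trans _ _ ((2 * pi)^-1%:E * (256 * (delta / a))%:E)).
  apply: lee_wpmul2l; first by rewrite lee_fin invr_ge0; lra.
  by apply: anticoncentration => //; exact: ltW.
rewrite -EFinM lee_fin mulrC ler_pdivrMr; last by lra.
have : (0 <= delta / a)%R by rewrite divr_ge0 // ltW.
move: (delta / a)%R => x x0.
have : (x * 2 <= x * pi)%R by rewrite ler_wpM2l.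
by lra.
Qed.

(** A pair of words below [i] either starts with the same letter, and is a pair
    of one of the subtrees, or parts at [i] and meets with small probability. *)
Lemma close_pairs_step i m (a := (r (size i) - r (size i).+1)%R) :
  (0 < a)%R -> (2 * (r (size i).+1 - r (m + (size i).+1)%N) <= a)%R ->
  (delta <= 3 / 40 * a)%R ->
  close_pairs i m.+1 <= \sum_(j < 4) close_pairs (j :: i) m +
     (16 * 16 ^+ m * (64 * (delta / a)))%:E.
Proof.
move=> a0 ha da; set c := (64 * (delta / a))%R.
have c0 : (0 <= c)%R by rewrite mulr_ge0// divr_ge0// ltW.
pose q i u v := P [set w | `|offset r (fun k => angle k w) theta i u -
               offset r (fun k => angle k w) theta i v| <= 2 * delta]%R.
have q0 k u v : 0 <= q k u v by exact: measure_ge0.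
have sum_const (x : R) (s : seq word) :
    \sum_(u <- s) x%:E = ((size s)%:R * x)%:E.
  by rewrite sumEFin big_const_seq count_predT iter_addr_0 mulr_natl.
have -> : close_pairs i m.+1 = \sum_(j < 4) \sum_(l < 4)
    \sum_(u <- words m) \sum_(v <- words m) q i (rcons u j) (rcons v l).
  rewrite /close_pairs big_wordsS; apply: eq_bigr => j _.
  by under eq_bigr do rewrite big_wordsS; rewrite exchange_big.
have -> : (16 * 16 ^+ m * c)%:E = \sum_(j < 4) \sum_(l < 4) (16 ^+ m * c)%:E.
  rewrite !big_const_ord !iterS /= !adde0 -!EFinD; congr (_%:E); ring.
rewrite -big_split/=; apply: lee_sum => j _.
rewrite (bigD1 j)//= [X in _ <= _ + X](bigD1 j)//= addeA; apply: leeD.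
  rewrite -[leLHS]adde0; apply: leeD; last by rewrite lee_fin mulr_ge0 ?exprn_ge0.
  apply: lee_sum => u _; apply: lee_sum => v _.
  rewrite le_eqVlt; apply/orP; left; apply/eqP; congr (P _).
  apply/seteqP; split => w /=; rewrite !offset_rcons opprD addrACA subrr add0r//.
apply: lee_sum => l lj.
apply: (@le_trans _ _ (\sum_(u <- words m) \sum_(v <- words m) c%:E)).
  rewrite big_seq [leRHS]big_seq; apply: lee_sum => u um.
  rewrite big_seq [leRHS]big_seq; apply: lee_sum => v vm.
  by apply: (prob_close_le (m := m)) => //; rewrite eq_sym.
under eq_bigr do rewrite sum_const.
rewrite sum_const size_words natrX lee_fin mulrA -exprMn.
by rewrite (_ : (4 * 4 = 16 :> R)%R)//; ring.
Qed.

Lemma mean_shadow_second_moment i m (lambda : R) : (0 <= lambda)%R ->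
  (2 * lambda * ((4 ^+ m) * (2 * delta)))%:E <=
  \int[P]_w shadow i m w + (lambda ^+ 2 * (2 * delta))%:E * close_pairs i m.
Proof.
move=> l0.
pose S u v := [set w | `|offset r (fun k => angle k w) theta i u -
                        offset r (fun k => angle k w) theta i v| <= 2 * delta]%R.
have mS u v : measurable (S u v) by exact: measurable_close.
pose G w := (lambda ^+ 2 * (2 * delta) *
  (\sum_(u <- words m) \sum_(v <- words m) \1_(S u v) w))%R.
have mi u v : measurable_fun setT (fun w => (\1_(S u v) w)%:E : \bar R).
  by apply/measurable_EFinP; exact: measurable_indic.
have l20 : (0 <= lambda ^+ 2 * (2 * delta))%R.
  by rewrite mulr_ge0 ?exprn_ge0// mulr_ge0// ltW.
have mG : measurable_fun setT (fun w => (G w)%:E).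
  apply/measurable_EFinP; apply: measurable_funM => //.
  apply: measurable_sum => u; apply: measurable_sum => v.
  exact: measurable_indic.
have intG : \int[P]_w (G w)%:E = (lambda ^+ 2 * (2 * delta))%:E * close_pairs i m.
  under eq_integral => w _ do rewrite /G EFinM -sumEFin.
  rewrite ge0_integralZl//; last 2 first.
  - by apply: emeasurable_sum => u; under eq_fun do rewrite -sumEFin;
      apply: emeasurable_sum => v.
  - by move=> w _; apply: sume_ge0 => u _; rewrite lee_fin sumr_ge0.
  congr (_ * _); rewrite ge0_integral_sum//; last 2 first.
  - by move=> u; under eq_fun do rewrite -sumEFin; apply: emeasurable_sum => v.
  - by move=> u w _; rewrite lee_fin sumr_ge0.
  apply: eq_bigr => u _; under eq_integral => w _ do rewrite -sumEFin.
  rewrite ge0_integral_sum//; apply: eq_bigr => v _.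
  by rewrite integral_indic// setIT.
rewrite -intG -ge0_integralD//; last 2 first.
- exact: measurable_shadow.
- by move=> w _; rewrite lee_fin mulr_ge0// !sumr_ge0// => u _; rewrite sumr_ge0.
rewrite -[leLHS]mule1 -(probability_setT P) -integral_cst//.
apply: ge0_le_integral_lower => w _.
  rewrite lee_fin !mulr_ge0 ?exprn_ge0// ltW//.
have := @lebesgue_measure_cover_ge _ _ (words m)
  (offset r (fun k => angle k w) theta i) delta lambda (ltW delta_gt0) l0.
rewrite size_words natrX => /le_trans; apply; apply: leeD2l; rewrite lee_fin.
rewrite /G ler_wpM2l//; apply: ler_sum => u _; apply: ler_sum => v _.
rewrite indicE /S; case: (leP `|_ - _|%R) => // h; rewrite ler_nat lt0b.
by rewrite inE.
Qed.

End random_tree.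

(** * The recursion satisfied by the comparison function *)

Section recursion.
Context {R : realType}.

(** The electrical resistance of an [m]-level quaternary tree rooted at level
    [k]: every node of level l carries a resistor [(r l)^-1] in series with its
    four subtrees, which are in parallel, and every leaf a resistor [delta^-1]. *)
Fixpoint resistance (r : nat -> R) (delta : R) (k m : nat) : R :=
  if m is m'.+1 then (r k)^-1 + resistance r delta k.+1 m' / 4 else delta^-1.

Lemma resistance_gt0 r delta k m : 0 < delta ->
  (forall l, (k <= l < k + m)%N -> 0 < r l) -> 0 < resistance r delta k m.
Proof.
move=> d0; elim: m k => [|m IHm] k r0 /=; first by rewrite invr_gt0.
have rk : 0 < r k by apply: r0; rewrite leqnn addnS ltnS leq_addr.
rewrite addr_gt0 ?invr_gt0// divr_gt0//; apply: IHm => l /andP[kl lm]; apply: r0.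
by rewrite (ltnW kl)/= -addSnnS.
Qed.

Lemma resistanceE r delta k m : resistance r delta k m =
  \sum_(0 <= j < m) (4 ^+ j * r (k + j)%N)^-1 + (4 ^+ m * delta)^-1.
Proof.
elim: m k => [|m IHm] k; first by rewrite big_geq//= expr0 mul1r add0r.
rewrite /= IHm big_nat_recl//= addn0 expr0 mul1r -addrA; congr (_ + _).
rewrite mulrDl mulr_suml; congr (_ + _).
  by apply: eq_bigr => j _; rewrite exprS -addSnnS !invfM; ring.
by rewrite exprS !invfM; ring.
Qed.

(** Let [b = 256 / H] and [c = (16 * r)^-1]. If [16 < r * H] then [c * b <= 1],
    so [x0 + x2 - c * x0 * x2] increases in each variable up to [b], which gives
    [e <= 4 * b - c * b ^+ 2]; this is at most the claimed value because
    [16 * c = r^-1] and [b * H = 256]. If [r * H <= 16] the claimed value is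
    larger than [3 * r]. *)
Lemma upper_recursion (r H e x0 x1 x2 x3 : R) : 0 < r -> 0 < H ->
  0 <= x0 -> 0 <= x2 -> x0 <= 256 / H -> x1 <= 256 / H -> x2 <= 256 / H ->
  x3 <= 256 / H -> e + (16 * r)^-1 * (x0 * x2) <= x0 + x1 + x2 + x3 ->
  e <= 3 * r -> e <= 256 / (r^-1 + H / 4).
Proof.
move=> r0 H0 x00 x20 h0 h1 h2 h3 he er.
have d0 : 0 < 1 + r * H / 4 by rewrite addr_gt0// divr_gt0// mulr_gt0.
have rE : r^-1 + H / 4 = r^-1 * (1 + r * H / 4).
  by rewrite mulrDr mulr1 !mulrA mulVf ?mul1r// gt_eqF.
have rr0 : 0 < r^-1 by rewrite invr_gt0.
rewrite ler_pdivlMr; last by rewrite rE mulr_gt0.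
have rV : r * r^-1 = 1 by rewrite mulfV// gt_eqF.
have [h|h] := leP (r * H) 16.
  have hb : r^-1 + H / 4 <= 5 / r by rewrite rE mulrC ler_wpM2r ?(ltW rr0)//; lra.
  have hp : 0 <= r^-1 + H / 4 by rewrite rE ltW// mulr_gt0.
  have : e * (r^-1 + H / 4) <= 3 * r * (r^-1 + H / 4) by rewrite ler_wpM2r.
  have : 3 * r * (r^-1 + H / 4) <= 3 * r * (5 / r).
    by rewrite ler_wpM2l// mulr_ge0// ltW.
  rewrite (_ : 3 * r * (5 / r) = 15 * (r * r^-1)); last by ring.
  by rewrite rV; lra.
set b := 256 / H in h0 h1 h2 h3 *.
have bH : b * H = 256 by rewrite divfK// gt_eqF.
have b0 : 0 < b by rewrite divr_gt0.
set c := (16 * r)^-1 in he *.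
have c0 : 0 < c by rewrite invr_gt0 mulr_gt0.
have cr : c * r = 16^-1 by rewrite /c invfM -mulrA mulVf ?mulr1// gt_eqF.
have cb : c * b <= 1.
  have : c * b * H <= 1 * H.
    rewrite -mulrA bH mul1r.
    have : c * 16 * 16 <= c * (r * H) * 16 by rewrite ler_wpM2r// ler_wpM2l// ltW.
    rewrite [c * (r * H)]mulrA cr; lra.
  by rewrite ler_pM2r.
have k1 : 0 <= (b - x0) * (1 - c * x2).
  by rewrite mulr_ge0 ?subr_ge0// (le_trans _ cb)// ler_pM2l.
have k2 : 0 <= (b - x2) * (1 - c * b) by rewrite mulr_ge0 ?subr_ge0.
have ke : e <= 4 * b - c * b * b by lra.
have hp : 0 <= r^-1 + H / 4 by rewrite rE ltW// mulr_gt0.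
apply: (@le_trans _ _ ((4 * b - c * b * b) * (r^-1 + H / 4))).
  by rewrite ler_wpM2r.
have rc : r^-1 = 16 * c by rewrite /c invfM mulrA mulfV ?mul1r// pnatr_eq0.
rewrite rc.
have -> : (4 * b - c * b * b) * (16 * c + H / 4) =
   64 * (c * b) + (b * H) - 16 * (c * b) ^+ 2 - (c * b) * (b * H) / 4 by field.
by rewrite bH; have := sqr_ge0 (c * b); lra.
Qed.

End recursion.

(** * Mean length of the projection in a fixed direction *)

Section correlation.
Context d (Omega : measurableType d) (R : realType) (P : probability Omega R).
Context (r : nat -> R) (theta delta : R).
Local Open Scope ereal_scope.

Lemma mean_square_ge (s : Omega -> \bar R) (b : R) :
  measurable_fun setT s -> (forall w, 0 <= s w <= b%:E) ->
  (\int[P]_w s w) * (\int[P]_w s w) <= \int[P]_w (s w * s w).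
Proof.
move=> ms sb.
have s0 w : 0 <= s w by have /andP[] := sb w.
have int0 : 0 <= \int[P]_w s w by exact: integral_ge0.
have intb : \int[P]_w s w <= b%:E.
  rewrite -[leRHS]mule1 -(probability_setT P) -integral_cst//.
  by apply: ge0_le_integral_lower => w _ //; have /andP[] := sb w.
have [e eE] : exists e, \int[P]_w s w = e%:E.
  exists (fine (\int[P]_w s w)); rewrite fineK// ge0_fin_numE//.
  by rewrite (le_lt_trans intb)// ltry.
have e0 : (0 <= e)%R by rewrite -lee_fin -eE.
have mss : measurable_fun setT (fun w => s w * s w) by exact: emeasurable_funM.
have h : \int[P]_w ((2 * e)%:E * s w) <= \int[P]_w (s w * s w + (e * e)%:E).
  apply: ge0_le_integral_lower => w _; first by rewrite mule_ge0// lee_fin mulr_ge0.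
  have /andP[] := sb w; case: (s w) => // x _ _.
  rewrite -!EFinM -EFinD lee_fin.
  by have := sqr_ge0 (x - e)%R; lra.
move: h; rewrite ge0_integralZl// ?lee_fin ?mulr_ge0//.
rewrite ge0_integralD//; last 2 first.
- by move=> w _; rewrite mule_ge0.
- by move=> w _; rewrite lee_fin mulr_ge0.
rewrite integral_cst//= probability_setT mule1 eE -!EFinM.
case: (\int[P]_w _) => [y| |]; rewrite ?leey//.
by rewrite -EFinD !lee_fin; lra.
Qed.

Lemma mean_product_independent d1 d2 (T1 : measurableType d1) (T2 : measurableType d2)
    (Y1 : Omega -> T1) (Y2 : Omega -> T2) (f : T1 -> \bar R) (g : T2 -> \bar R) :
  measurable_fun setT Y1 -> measurable_fun setT Y2 ->
  (forall A B, measurable A -> measurable B ->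
    P (Y1 @^-1` A `&` Y2 @^-1` B) = P (Y1 @^-1` A) * P (Y2 @^-1` B)) ->
  measurable_fun setT f -> measurable_fun setT g ->
  (forall x, 0 <= f x) -> (forall x, 0 <= g x) ->
  \int[P]_w (f (Y1 w) * g (Y2 w)) = \int[P]_w f (Y1 w) * \int[P]_w g (Y2 w).
Proof.
move=> m1 m2 indep mf mg f0 g0.
have mF : measurable_fun setT (fun z : T1 * T2 => f z.1 * g z.2).
  by apply: emeasurable_funM; apply: measurableT_comp.
rewrite (ge0_integral_independent_pair (F := fun z : T1 * T2 => f z.1 * g z.2)
  m1 m2 indep mF); last by move=> z; rewrite mule_ge0.
have mfY : measurable_fun setT (fun w => f (Y1 w)) by exact: measurableT_comp.
have mgY : measurable_fun setT (fun w => g (Y2 w)) by exact: measurableT_comp.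
transitivity (\int[P]_w2 (g (Y2 w2) * \int[P]_w1 f (Y1 w1))).
  apply: eq_integral => w2 _ /=; rewrite muleC -ge0_integralZr//.
rewrite ge0_integralZr// 1?muleC//; exact: integral_ge0.
Qed.

Lemma eq_offset (om : word -> R) (i i' u : word) :
  size i = size i' -> (forall v v', size v = size v' -> om v = om v') ->
  offset r om theta i u = offset r om theta i' u.
Proof.
move=> ii' omE; elim: u => //= j u ->; congr (_ + _)%R.
by rewrite /displacement !size_cat ii' (omE (u ++ i) (u ++ i'))// !size_cat ii'.
Qed.

Context (I : eqType) (X : I -> {RV P >-> R}) (phi : word -> I).
Local Notation sh := (shadow X phi r theta delta).

Lemma shadow_le_trivial i m w : (0 <= delta)%R ->
  sh i m w <= ((4 ^ m)%:R * (2 * delta))%:E.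
Proof. by move=> d0; rewrite -size_words; exact: lebesgue_measure_cover_le. Qed.

Lemma shadow_le_radius i m w : (forall n, r n.+1 <= r n)%R -> (0 < delta)%R ->
  (forall n, 0 <= r n)%R ->
  sh i m w <= (2 * (r (size i) + delta))%:E.
Proof.
move=> rS d0 r0.
pose B : set R := [set x | `|x - 0| <= r (size i) + delta]%R.
have <- : lebesgue_measure B = (2 * (r (size i) + delta))%:E.
  by apply: lebesgue_measure_segment; rewrite addr_ge0// ltW.
apply: le_lebesgue_measure => x /hasP[u _ /= xu]; rewrite /B /= subr0.
have := @offset_bound _ r (fun v => angle X phi v w) theta i u rS.
move: xu; set y := offset _ _ _ _ _ => xu hy.
have := ler_normD (x - y)%R y; rewrite subrK.
by have := r0 (size u + size i)%N; lra.
Qed.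

(** The only property of the joint law of distinct subtrees used for the upper
    bound, and the one that distinguishes the two models. *)
Definition positively_correlated :=
  forall i m, \int[P]_w sh (@letter 0 isT :: i) m w *
              \int[P]_w sh (@letter 2 isT :: i) m w <=
    \int[P]_w (sh (@letter 0 isT :: i) m w * sh (@letter 2 isT :: i) m w).

(** Here the two subtrees are translates of each other, and the claim is
    Jensen's inequality for the square. *)
Lemma synchronized_positively_correlated : (0 <= delta)%R ->
  (forall v v', size v = size v' -> phi v = phi v') -> positively_correlated.
Proof.
move=> d0 phiE i m.
have -> : sh (@letter 2 isT :: i) m = sh (@letter 0 isT :: i) m.
  apply/funext => w; rewrite /shadow.
  congr (lebesgue_measure (interval_cover _ _ _)); apply/funext => u.
  by apply: eq_offset => // v v' /phiE; rewrite /angle => ->.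
apply: (@mean_square_ge _ ((4 ^ m)%:R * (2 * delta))%R).
  exact: measurable_shadow.
by move=> w; rewrite shadow_ge0 shadow_le_trivial.
Qed.

Definition subtree (i : word) (j : 'I_4) : set word := [set v ++ j :: i | v in setT].

Lemma subtree_disjoint i (j l : 'I_4) : j != l ->
  subtree i j `&` subtree i l = set0.
Proof.
move=> jl; apply/seteqP; split => // _ [[v _ <-] [v' _]] /eqP.
have [sv|sv] := eqVneq (size v') (size v).
  by rewrite eqseq_cat// eqseq_cons (eq_sym l) (negbTE jl) /= andbF.
by move/eqP/(congr1 size); rewrite !size_cat /= => /addIn /eqP; rewrite (negbTE sv).
Qed.

(** Here the two shadows are functions of disjoint families of angles, and the
    inequality is an equality. *)
Lemma independent_positively_correlated :
  injective phi -> mutually_independent X -> positively_correlated.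
Proof.
move=> phi_inj indep i m.
pose J j := [set phi v | v in subtree i j].
pose T j := g_sigma_algebraType (events_of X (J j)).
have mid j : measurable_fun setT (idfun : Omega -> T j).
  move=> _ A mA; rewrite setTI preimage_id.
  move: A mA; apply: smallest_sub; first exact: sigma_algebra_measurable.
  exact: (@events_of_measurable _ _ _ P _ X (J j)).
have msh j : measurable_fun setT (sh (j :: i) m : T j -> \bar R).
  apply: (@measurable_fun_interval_cover _ _ (T j) _
    (fun u w => offset r (fun v => angle X phi v w) theta (j :: i) u)) => u.
  apply: (@measurable_offset _ _ _ (T j) (angle X phi) (fun=> theta)) => //.
  move=> v _ A mA; rewrite setTI; apply: sub_sigma_algebra.
  exists (phi (v ++ j :: i)), A; split => //.
  by exists (v ++ j :: i) => //; exists v.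
rewrite le_eqVlt; apply/orP; left; apply/eqP/esym.
apply: (mean_product_independent (mid _) (mid _) _ (msh _) (msh _)) => //.
move=> A B mA mB; rewrite !preimage_id.
apply: (@sigma_blocks_independent _ _ _ _ _ X indep
  (J (@letter 0 isT)) (J (@letter 2 isT))) => //.
apply/seteqP; split => // k [[v vi <-] [v' v'i /phi_inj e]].
have : (subtree i (@letter 0 isT) `&` subtree i (@letter 2 isT)) v.
  by split => //; rewrite -e.
by rewrite subtree_disjoint.
Qed.

Hypothesis X_iid : iid_uniform_angles X.
Hypothesis phi_fresh : forall i v j, phi (v ++ j :: i) != phi i.
Hypothesis theta_pi : (0 <= theta <= pi)%R.
Hypothesis delta_gt0 : (0 < delta)%R.
Hypothesis r_adm : admissible r.
Variable n : nat.
Hypothesis r_gt0 : forall k, (k < n)%N -> (0 < r k)%R.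
Hypothesis delta_small : forall k, (k < n)%N -> (20 * delta <= r k)%R.

Let r_ge0 k : (0 <= r k)%R. Proof. by have [] := r_adm. Qed.
Let r_decr k : (r k.+1 <= r k)%R. Proof. by have [] := r_adm. Qed.
Let r_third k : (3 * r k.+1 <= r k)%R.
Proof. by have [_ _ /(_ k)] := r_adm; lra. Qed.

Let resistance_tail_gt0 (i : word) m : (size i + m = n)%N ->
  (0 < resistance r delta (size i) m)%R.
Proof.
move=> im; apply: resistance_gt0 => // l /andP[_ lm]; apply: r_gt0.
by rewrite -im.
Qed.

(** Induction on the height of the tree. The overlap of two subtrees is bounded
    below by the product of their mean lengths, and [upper_recursion] closes
    the step. *)
Lemma mean_shadow_le i m : positively_correlated -> (size i + m = n)%N ->
  \int[P]_w sh i m w <= (256 / resistance r delta (size i) m)%:E.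
Proof.
move=> corr; elim: m i => [|m IHm] i im.
  rewrite /= invrK -[leRHS]mule1 -(probability_setT P) -integral_cst//.
  apply: ge0_le_integral_lower => w _; first exact: shadow_ge0.
  apply: le_trans (shadow_le_trivial _ _ _ (ltW delta_gt0)) _.
  by rewrite expn0 lee_fin mul1r; have := delta_gt0; lra.
have kn : (size i < n)%N by rewrite -im addnS ltnS leq_addr.
have IH j := IHm (j :: i) (etrans (addSnnS _ _) im).
have Hpos : (0 < resistance r delta (size i).+1 m)%R.
  by apply: (@resistance_tail_gt0 (ord0 :: i) m); rewrite /= addSnnS.
have int0 k l : 0 <= \int[P]_w sh k l w.
  by apply: integral_ge0 => w _; exact: shadow_ge0.
have real k l b : \int[P]_w sh k l w <= b%:E ->
    \int[P]_w sh k l w = (fine (\int[P]_w sh k l w))%:E.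
  by move=> h; rewrite fineK// ge0_fin_numE// (le_lt_trans h)// ltry.
have rk := r_gt0 kn; have dk := delta_small kn; have r3 := r_third (size i).
have r1 := r_ge0 (size i).+1; have r2 := r_ge0 (m + (size i).+1)%N.
have d0 := delta_gt0.
have triv : \int[P]_w sh i m.+1 w <= (3 * r (size i))%:E.
  rewrite -[leRHS]mule1 -(probability_setT P) -integral_cst//.
  apply: ge0_le_integral_lower => w _; first exact: shadow_ge0.
  apply: le_trans (shadow_le_radius _ _ _ r_decr delta_gt0 r_ge0) _.
  by rewrite lee_fin; lra.
have a0 : (0 < r (size i) - r (size i).+1)%R by lra.
have step := @mean_shadow_step _ _ _ P _ X phi r theta delta X_iid phi_fresh
  r_decr theta_pi i m a0.
have /step {step} : (r (size i).+1 - r (m + (size i).+1)%N + delta <=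
    r (size i) - r (size i).+1)%R by lra.
have lec : (16 * r (size i))^-1%:E <=
    (4 * pi * (r (size i) - r (size i).+1))^-1%:E :> \bar R.
  have pi4 : (pi < 4 :> R)%R by have := @pihalf_lt2 R; lra.
  have p0 := @pi_gt0 R.
  rewrite lee_fin lef_pV2 ?posrE ?mulr_gt0//.
  have : (pi * (r (size i) - r (size i).+1) <= 4 * r (size i))%R.
    by apply: ler_pM; lra.
  lra.
move=> step.
have {}step := le_trans (leeD2l _ (lee_pmul _ (mule_ge0 (int0 _ _) (int0 _ _)) lec (corr i m))) step.
have {step} := step _; rewrite lee_fin invr_ge0 mulr_ge0// => /(_ isT).
rewrite big_letters.
have {}IH j : exists x, [/\ \int[P]_w sh (j :: i) m w = x%:E, (0 <= x)%R &
    (x <= 256 / resistance r delta (size i).+1 m)%R].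
  exists (fine (\int[P]_w sh (j :: i) m w)); split.
  - exact: real (IH j).
  - exact: fine_ge0.
  - by rewrite -lee_fin -(real _ _ _ (IH j)); exact: IH.
have [x0 [-> x00 x0b]] := IH (@letter 0 isT).
have [x1 [-> _ x1b]] := IH (@letter 1 isT).
have [x2 [-> x20 x2b]] := IH (@letter 2 isT).
have [x3 [-> _ x3b]] := IH (@letter 3 isT).
have eE := real _ _ _ triv; move: triv; rewrite eE; set e := fine _.
rewrite -!EFinM -!EFinD !lee_fin => triv step.
exact: upper_recursion step triv.
Qed.

(** The bound satisfies the same recursion as [resistance]: a pair that stays
    together costs the resistance of a subtree, a pair that parts at level k
    costs [(r k)^-1]. *)
Lemma close_pairs_le i m : (size i + m = n)%N ->
  close_pairs X phi r theta delta i m <=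
    (96 * delta * 16 ^+ m * resistance r delta (size i) m)%:E.
Proof.
elim: m i => [|m IHm] i im.
  rewrite /close_pairs /= !big_seq1 mulr1 -mulrA mulfV ?gt_eqF//.
  apply: le_trans (probability_le1 _ _) _; last by rewrite lee_fin; lra.
  exact: measurable_close.
have kn : (size i < n)%N by rewrite -im addnS ltnS leq_addr.
have IH j := IHm (j :: i) (etrans (addSnnS _ _) im).
have rk := r_gt0 kn; have dk := delta_small kn; have r3 := r_third (size i).
have r1 := r_ge0 (size i).+1; have r2 := r_ge0 (m + (size i).+1)%N.
have d0 := delta_gt0.
have a0 : (0 < r (size i) - r (size i).+1)%R by lra.
apply: le_trans (@close_pairs_step _ _ _ P _ X phi r theta delta X_iid phi_fresh
  r_decr delta_gt0 i m a0 _ _) _; [lra|lra|].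
have h : \sum_(j < 4) close_pairs X phi r theta delta (j :: i) m <=
    \sum_(j < 4) (96 * delta * 16 ^+ m * resistance r delta (size i).+1 m)%:E.
  by apply: lee_sum => j _; exact: IH.
apply: le_trans (leeD2r _ h) _.
rewrite sumEFin -EFinD lee_fin big_const_ord !iterS/=.
set H := resistance _ _ _ _.
have : (delta / (r (size i) - r (size i).+1) <= delta * (3 / 2 * (r (size i))^-1))%R.
  rewrite ler_wpM2l ?(ltW d0)// (_ : 3 / 2 * _ = (2 / 3 * r (size i))^-1)%R; last first.
    by rewrite invfM invf_div.
  by rewrite lef_pV2 ?posrE; lra.
set D := (delta / _)%R; set rV := (r _)^-1%R => hD.
have : (16 ^+ m * D <= 16 ^+ m * (delta * (3 / 2 * rV)))%R by rewrite ler_wpM2l// exprn_ge0.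
rewrite exprS; set E := (16 ^+ m)%R => hE.
have -> : (96 * delta * (16 * E) * (rV + H / 4) =
  4 * (96 * delta * E * H) + 16 * 64 * (E * (delta * (3 / 2 * rV))))%R by field.
lra.
Qed.

(** The second moment bound for the whole tree, at the value of [lambda] that
    maximises it. *)
Lemma mean_shadow_ge :
  ((48 * resistance r delta 0 n)^-1)%:E <= \int[P]_w sh [::] n w.
Proof.
have := @close_pairs_le [::] n erefl.
have := @resistance_tail_gt0 [::] n erefl => /=.
set H := resistance _ _ _ _ => H0 hQ.
have d0 := delta_gt0.
have e0 : (0 < 4 ^+ n :> R)%R by rewrite exprn_gt0.
pose lambda := ((96 * delta * 4 ^+ n * H)^-1)%R.
have l0 : (0 < lambda)%R by rewrite invr_gt0 !mulr_gt0.
have := @mean_shadow_second_moment _ _ _ P _ X phi r theta delta delta_gt0 [::] n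
  lambda (ltW l0).
have c0 : (0 <= lambda ^+ 2 * (2 * delta))%R by rewrite mulr_ge0 ?exprn_ge0 ?ltW// mulr_gt0.
have := lee_wpmul2l (_ : 0 <= (lambda ^+ 2 * (2 * delta))%:E) hQ.
rewrite lee_fin c0 => /(_ isT) h2 h1.
have {h1 h2} := le_trans h1 (leeD2l _ h2).
rewrite -EFinM -leeBlDr// -EFinB; apply: le_trans; rewrite lee_fin.
have e16 : (16 ^+ n = 4 ^+ n * 4 ^+ n :> R)%R.
  by rewrite -exprMn (_ : (4 * 4 = 16 :> R)%R)//; ring.
have lE : (lambda * (96 * delta * 4 ^+ n * H) = 1)%R.
  by rewrite /lambda mulVf// gt_eqF// !mulr_gt0.
have -> : (lambda ^+ 2 * (2 * delta) * (96 * delta * 16 ^+ n * H) =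
   2 * delta * 4 ^+ n * lambda * (lambda * (96 * delta * 4 ^+ n * H)))%R.
  by rewrite e16; ring.
rewrite lE mulr1.
have -> : ((48 * H)^-1 = 2 * delta * 4 ^+ n * lambda)%R.
  rewrite /lambda; field.
  by rewrite !gt_eqF.
by rewrite le_eqVlt; apply/orP; left; apply/eqP; ring.
Qed.

End correlation.

(** * Discs, their projections and the limit set *)

Section plane_geometry.
Context {R : realType}.
Implicit Types x y z : R * R.

Lemma eucl_distC x y : eucl_dist x y = eucl_dist y x.
Proof.
by rewrite /eucl_dist -[in LHS](opprB y.1) -[in LHS](opprB y.2) !sqrrN.
Qed.

Lemma eucl_dist_ge0 x y : 0 <= eucl_dist x y.
Proof. exact: sqrtr_ge0. Qed.

Lemma sqr_eucl_dist x y :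
  eucl_dist x y ^+ 2 = (x.1 - y.1) ^+ 2 + (x.2 - y.2) ^+ 2.
Proof. by rewrite sqr_sqrtr// addr_ge0// sqr_ge0. Qed.

Lemma eucl_dist_le x y (c : R) : 0 <= c ->
  (x.1 - y.1) ^+ 2 + (x.2 - y.2) ^+ 2 <= c ^+ 2 -> eucl_dist x y <= c.
Proof.
move=> c0 h; rewrite -(@ler_pXn2r _ 2) ?nnegrE ?eucl_dist_ge0//.
by rewrite sqr_eucl_dist.
Qed.

(** Cauchy-Schwarz, from Lagrange's identity. *)
Lemma dot_le_eucl_dist x y (p q : R) :
  p * (x.1 - y.1) + q * (x.2 - y.2) <= Num.sqrt (p ^+ 2 + q ^+ 2) * eucl_dist x y.
Proof.
have pq : 0 <= p ^+ 2 + q ^+ 2 by rewrite addr_ge0// sqr_ge0.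
apply: (le_trans (ler_norm _)).
rewrite -(@ler_pXn2r _ 2) ?nnegrE ?mulr_ge0 ?sqrtr_ge0 ?eucl_dist_ge0//.
rewrite exprMn sqr_eucl_dist sqr_sqrtr// real_normK ?num_real//.
set a := x.1 - y.1; set b := x.2 - y.2.
rewrite -subr_ge0 (_ : _ - _ = (p * b - q * a) ^+ 2) ?sqr_ge0//; ring.
Qed.

Lemma eucl_dist_triangle x y z : eucl_dist x z <= eucl_dist x y + eucl_dist y z.
Proof.
apply: eucl_dist_le; first by rewrite addr_ge0 ?eucl_dist_ge0.
rewrite [leRHS]sqrrD !sqr_eucl_dist.
have := dot_le_eucl_dist y z (x.1 - y.1) (x.2 - y.2).
rewrite -/(eucl_dist x y).
have -> : (x.1 - z.1) ^+ 2 + (x.2 - z.2) ^+ 2 =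
  (x.1 - y.1) ^+ 2 + (x.2 - y.2) ^+ 2 + ((y.1 - z.1) ^+ 2 + (y.2 - z.2) ^+ 2)
  + ((x.1 - y.1) * (y.1 - z.1) + (x.2 - y.2) * (y.2 - z.2)) *+ 2 by ring.
by move=> h; rewrite !mulr2n; lra.
Qed.

Lemma line_proj_lipschitz (theta : R) x y :
  `|line_proj theta x - line_proj theta y| <= eucl_dist x y.
Proof.
have h u v : line_proj theta u - line_proj theta v <= eucl_dist u v.
  have := dot_le_eucl_dist u v (cos theta) (sin theta).
  rewrite cos2Dsin2 sqrtr1 mul1r; apply: le_trans.
  by rewrite /line_proj le_eqVlt; apply/orP; left; apply/eqP; ring.
rewrite ler_norml h andbT lerNl opprB eucl_distC; exact: h.
Qed.

(** The preimage of [t] is the point of the diameter in the direction [theta]. *)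
Lemma line_proj_disc (theta rho : R) x : line_proj theta @` disc x rho =
  [set t | `|t - line_proj theta x| <= rho].
Proof.
apply/seteqP; split => t.
  move=> [y xy <-] /=; apply: (le_trans (line_proj_lipschitz _ _ _)).
  by rewrite eucl_distC.
move=> /= ht; set s := t - line_proj theta x in ht.
exists (x.1 + s * cos theta, x.2 + s * sin theta).
  apply: eucl_dist_le => /=; first exact: le_trans ht.
  rewrite !opprD !addrA !subrr !sub0r !sqrrN !exprMn -mulrDr cos2Dsin2 mulr1.
  exact: ler_sqr_of_norm.
rewrite /line_proj/=.
have -> : (x.1 + s * cos theta) * cos theta + (x.2 + s * sin theta) * sin theta =
   line_proj theta x + s * (cos theta ^+ 2 + sin theta ^+ 2).
  by rewrite /line_proj; ring.
by rewrite cos2Dsin2 mulr1 /s addrC subrK.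
Qed.

Lemma eucl_dist_displaced x (s t : R) : 0 <= s ->
  eucl_dist x (x + s *: unit_vector t) = s.
Proof.
move=> s0; rewrite /eucl_dist /unit_vector /= !opprD !addrA !subrr !sub0r !sqrrN.
by rewrite /GRing.scale/= !exprMn -mulrDr cos2Dsin2 mulr1 sqrtr_sqr ger0_norm.
Qed.

End plane_geometry.

Section cantor_geometry.
Context {R : realType}.
Variable r : nat -> R.
Hypothesis r_adm : admissible r.
Variable omega : word -> R.

Let r_ge0 k : 0 <= r k. Proof. by have [] := r_adm. Qed.
Let r_decr k : r k.+1 <= r k. Proof. by have [] := r_adm. Qed.

Lemma radius_decreasing m n : (m <= n)%N -> r n <= r m.
Proof.
move=> /subnK <-; elim: (n - m)%N => // k IHk.
by rewrite addSn; exact: le_trans (r_decr _) IHk.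
Qed.

(** The ratio 1/3 gives at least [r n <= r 0 / (n + 1)]. *)
Lemma radius_small (e : R) m : 0 < e -> exists2 l, (m <= l)%N & r l < e.
Proof.
move=> e0.
have rn n : r n * n.+1%:R <= r 0.
  elim: n => [|n IHn]; first by rewrite mulr1.
  apply: le_trans IHn; have [_ _ /(_ n) h] := r_adm.
  have -> : n.+2%:R = n.+1%:R + 1 :> R by rewrite natr1.
  have n1 : 1 <= n.+1%:R :> R by rewrite ler1n.
  have := r_ge0 n; have := ler_wpM2l (r_ge0 n) n1.
  have : r n.+1 * (n.+1%:R + 1) <= 3^-1 * r n * (n.+1%:R + 1).
    by rewrite ler_wpM2r// addr_ge0.
  by lra.
exists (maxn m (Num.truncn (r 0 / e))); first exact: leq_maxl.
set l := maxn _ _.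
have hl : r 0 / e < l.+1%:R.
  apply: (@lt_le_trans _ _ (Num.truncn (r 0 / e)).+1%:R).
    exact: truncnS_gt.
  by rewrite ler_nat ltnS leq_maxr.
have l0 : 0 < l.+1%:R :> R by rewrite ltr0n.
rewrite -(ltr_pM2r l0); apply: le_lt_trans (rn l) _.
by rewrite mulrC -ltr_pdivrMr.
Qed.

Lemma disc_center_descendant v i :
  eucl_dist (disc_center r omega i) (disc_center r omega (v ++ i)) <=
  r (size i) - r (size v + size i)%N.
Proof.
elim: v => [|j v IHv] /=.
  rewrite subrr; apply: eucl_dist_le => //.
  by rewrite !subrr expr0n/= addr0.
apply: (le_trans (eucl_dist_triangle _ (disc_center r omega (v ++ i)) _)).
rewrite eucl_dist_displaced ?subr_ge0// size_cat addSn.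
by move: IHv; lra.
Qed.

(** The centres of the descendants of [i] through the letter 0 converge, because
    the discs around them are nested and shrink. The limit is built one
    coordinate at a time as a supremum, which locates it only up to a factor 2;
    letting the level of comparison tend to infinity removes this factor. *)
Lemma cantor_limit_meets_disc i : exists2 p, cantor_limit r omega p &
  eucl_dist (disc_center r omega i) p <= r (size i).
Proof.
pose c m := disc_center r omega (nseq m ord0 ++ i).
pose k := size i.
have cc m l : (m <= l)%N -> eucl_dist (c m) (c l) <= r (m + k)%N - r (l + k)%N.
  move=> ml; have := disc_center_descendant (nseq (l - m) ord0) (nseq m ord0 ++ i).
  rewrite catA -nseqD subnK// size_cat !size_nseq addnA subnK//.
have coord (f : R * R -> R) :
    (forall x y, `|f x - f y| <= eucl_dist x y) ->
    exists q, forall m, `|f (c m) - q| <= r (m + k)%N.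
  move=> f1.
  have ub m l : f (c m) - r (m + k)%N <= f (c l) + r (l + k)%N.
    have [ml|/ltnW lm] := leqP m l.
      have := le_trans (f1 _ _) (cc _ _ ml); rewrite ler_norml => /andP[_].
      by have := r_ge0 (l + k); lra.
    have := le_trans (f1 _ _) (cc _ _ lm); rewrite ler_norml => /andP[+ _].
    by have := r_ge0 (m + k); lra.
  pose A := [set f (c m) - r (m + k)%N | m in setT].
  have supA : has_sup A.
    split; first by exists (f (c 0) - r (0 + k)%N); exists 0%N.
    by exists (f (c 0) + r (0 + k)%N) => _ [m _ <-].
  exists (sup A) => m; rewrite ler_norml; apply/andP; split.
    rewrite lerBrDl -lerBrDr opprK; apply: ge_sup; first exact: supA.1.
    by move=> _ [l _ <-].
  by rewrite lerBlDl -lerBlDr; apply: (ub_le_sup supA.2); exists m.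
have c1 : forall x y : R * R, `|x.1 - y.1| <= eucl_dist x y.
  move=> x y; have := line_proj_lipschitz 0 x y.
  by rewrite /line_proj cos0 sin0 !mulr1 !mulr0 !addr0.
have c2 : forall x y : R * R, `|x.2 - y.2| <= eucl_dist x y.
  move=> x y; have := line_proj_lipschitz (pi / 2) x y.
  by rewrite /line_proj cos_pihalf sin_pihalf !mulr1 !mulr0 !add0r.
have [p1 hp1] := coord fst c1; have [p2 hp2] := coord snd c2.
have weak m : eucl_dist (c m) (p1, p2) <= 2 * r (m + k)%N.
  apply: eucl_dist_le => /=; first by rewrite mulr_ge0.
  have := ler_sqr_of_norm (hp1 m); have := ler_sqr_of_norm (hp2 m).
  by have := sqr_ge0 (r (m + k)%N); rewrite /=; lra.
have strong m : eucl_dist (c m) (p1, p2) <= r (m + k)%N.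
  apply/ler_addgt0Pr => e e0.
  have [l ml rl] := radius_small m e0.
  have rlk : r (l + k)%N <= r l by apply: radius_decreasing; exact: leq_addr.
  apply: (le_trans (eucl_dist_triangle _ (c l) _)).
  by have := weak l; have := cc _ _ ml; lra.
exists (p1, p2); last exact: strong 0%N.
move=> n _; have [kn|nk] := leqP k n.
  exists (nseq (n - k) ord0 ++ i); first by rewrite /= size_cat size_nseq subnK.
  rewrite /cantor_disc /disc /= size_cat size_nseq.
  exact: strong.
exists (drop (k - n) i); first by rewrite /= size_drop subKn// ltnW.
rewrite /cantor_disc /disc /= size_drop -/k subKn ?(ltnW nk)//.
apply: (le_trans (eucl_dist_triangle _ (c 0%N) _)).
have := disc_center_descendant (take (k - n) i) (drop (k - n) i).
rewrite cat_take_drop size_drop size_takel ?leq_subr// -/k subKn ?(ltnW nk)//.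
rewrite subnK ?(ltnW nk)// => h1; have := strong 0%N; rewrite add0n => h2.
by move: h1 h2; rewrite /c /=; lra.
Qed.

Lemma disc_sub_neighborhood i (rho : R) :
  disc (disc_center r omega i) (rho - r (size i)) `<=`
  neighborhood (cantor_limit r omega) rho.
Proof.
move=> x hx; have [p Kp hp] := cantor_limit_meets_disc i.
rewrite /neighborhood /dist_to_set /=; apply: ge_ereal_inf.
exists (eucl_dist x p)%:E; first by exists p.
rewrite lee_fin; apply: (le_trans (eucl_dist_triangle _ (disc_center r omega i) _)).
by rewrite eucl_distC; move: hx hp; rewrite /disc/=; lra.
Qed.

(** The distance to the limit set need only be attained up to [rho], whence 3
    rather than 2 in the conclusion. *)
Lemma neighborhood_sub_discs n (rho : R) : 0 < rho -> r n <= rho ->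
  neighborhood (cantor_limit r omega) rho `<=`
  \bigcup_(u in [set u : word | size u = n]) disc (disc_center r omega u) (3 * rho).
Proof.
move=> rho0 rn x hx.
have [y Ky xy] : exists2 y, cantor_limit r omega y & eucl_dist x y <= 2 * rho.
  apply: contrapT => h; move: hx; rewrite /neighborhood /=; apply/negP.
  rewrite -ltNge; apply: (@lt_le_trans _ _ (2 * rho)%:E); first by rewrite lte_fin; lra.
  apply: le_ereal_inf_tmp => _ [y Ky <-]; rewrite lee_fin leNgt; apply/negP => xy.
  by apply: h; exists y => //; exact: ltW.
have [u /= un uy] := Ky n I; exists u => //.
rewrite /disc /=; apply: (le_trans (eucl_dist_triangle _ y _)).
by rewrite (eucl_distC y); move: uy; rewrite /cantor_disc /disc /= un; lra.
Qed.

End cantor_geometry.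

(** * Averaging over directions *)

Section mean_favard.
Context d (Omega : measurableType d) (R : realType) (P : probability Omega R).
Context (I : eqType) (X : I -> {RV P >-> R}) (phi : word -> I).
Variables (r : nat -> R) (delta : R) (n : nat).
Hypothesis X_iid : iid_uniform_angles X.
Hypothesis phi_fresh : forall i v j, phi (v ++ j :: i) != phi i.
Hypothesis X_corr : forall theta, positively_correlated r theta delta X phi.
Hypothesis delta_gt0 : 0 < delta.
Hypothesis r_adm : admissible r.
Hypothesis r_gt0 : forall k, (k < n)%N -> 0 < r k.
Hypothesis delta_small : forall k, (k < n)%N -> 20 * delta <= r k.
Local Notation mu := (@lebesgue_measure R).
Local Notation H := (resistance r delta 0 n).
Local Notation center w u := (disc_center r (fun v => angle X phi v w) u).
Local Open Scope ereal_scope.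

Let sh (theta : R) w := shadow X phi r theta delta [::] n w.

Let measurable_sh : measurable_fun setT (fun z : Omega * R => sh z.2 z.1).
Proof.
apply: (@measurable_fun_interval_cover _ _ (Omega * R)%type _
  (fun u z => offset r (fun v => angle X phi v z.1) z.2 [::] u)) => u.
apply: (@measurable_offset _ _ _ (Omega * R)%type
  (fun v z => angle X phi v z.1) snd) => //.
by move=> v; apply: measurableT_comp => //; exact: measurable_angle.
Qed.

Let f (z : Omega * R) := sh z.2 z.1 * (\1_(`[0%R, pi]%classic) z.2)%:E.

Let measurable_f : measurable_fun setT f.
Proof.
apply: emeasurable_funM => //; apply/measurable_EFinP.
by apply: measurableT_comp => //; apply: measurable_indic; exact: measurable_itv.
Qed.

Let f_ge0 z : 0 <= f z.
Proof. by rewrite mule_ge0 ?shadow_ge0// lee_fin. Qed.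

Let integral_f w :
  \int[mu]_(theta in `[0%R, pi]) sh theta w = \int[mu]_theta f (w, theta).
Proof.
rewrite integral_mkcond; apply: eq_integral => t _.
by rewrite /f patchE indicE; case: ifP; rewrite ?mule1 ?mule0.
Qed.

Let measurable_sh_angle w : measurable_fun `[0%R, pi] (sh ^~ w).
Proof.
have m : measurable_fun setT (sh ^~ w).
  apply: (@measurable_fun_interval_cover _ _ R _
    (fun u t => offset r (fun v => angle X phi v w) t [::] u)) => u.
  by apply: (@measurable_offset _ _ _ R (fun v _ => angle X phi v w) id).
exact: measurable_funTS.
Qed.

Let measurable_integral_sh :
  measurable_fun setT (fun w => \int[mu]_(theta in `[0%R, pi]) sh theta w).
Proof.
under eq_fun do rewrite integral_f.
exact: (measurable_fun_fubini_tonelli_F (m2 := mu) f measurable_f f_ge0).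
Qed.

Lemma shadow_fubini :
  \int[P]_w \int[mu]_(theta in `[0%R, pi]) sh theta w =
  \int[mu]_(theta in `[0%R, pi]) \int[P]_w sh theta w.
Proof.
under eq_integral do rewrite integral_f.
rewrite (fubini_tonelli (m1 := P) (m2 := mu) f measurable_f f_ge0).
rewrite [RHS]integral_mkcond; apply: eq_integral => t _.
rewrite /f /= ge0_integralZr//; last exact: measurable_shadow.
by rewrite patchE indicE; case: ifP; rewrite ?mule1 ?mule0.
Qed.

Lemma line_proj_center theta w u :
  line_proj theta (center w u) = offset r (fun v => angle X phi v w) theta [::] u.
Proof. exact: line_proj_disc_center. Qed.

(** Each projected disc of radius [delta] is the interval of radius [delta]
    around the projected centre; then integrate the bound for a fixed direction
    over the interval [0, pi] of directions. *)
Lemma mean_Fav_ge (E : Omega -> set (R * R)) :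
  (forall w u, size u = n -> disc (center w u) delta `<=` E w) ->
  (pi / (48 * H))%:E <= mean P (fun w => Fav (E w)).
Proof.
move=> hE; have H0 : (0 < H)%R by apply: resistance_gt0 => // k /andP[_ /r_gt0].
apply: (@le_trans _ _ (\int[P]_w \int[mu]_(theta in `[0%R, pi]) sh theta w)).
  rewrite shadow_fubini.
  have -> : (pi / (48 * H))%:E =
      \int[mu]_(theta in `[0%R, pi]) ((48 * H)^-1)%:E.
    rewrite integral_cst//= lebesgue_measure_itv/= lte_fin pi_gt0 sube0.
    by rewrite -EFinM mulrC.
  apply: ge0_le_integral_lower => t; rewrite /= in_itv/= => ht.
    by rewrite lee_fin invr_ge0 mulr_ge0// ltW.
  exact: mean_shadow_ge.
apply: ge0_le_integral_lower => w _.
  by apply: integral_ge0 => t _; exact: shadow_ge0.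
apply: ge0_le_integral_lower => t _; first exact: shadow_ge0.
apply: le_lebesgue_measure => x /hasP[u]; rewrite mem_words => /eqP un xu.
have : (line_proj t @` disc (center w u) delta) x.
  by rewrite line_proj_disc /= line_proj_center.
by move=> [z hz <-]; exists z => //; exact: hE un _ hz.
Qed.

(** Dilating the intervals by [64 = 2 ^+ 6] multiplies the length of their
    union by at most 64. This slack lets [delta] be much smaller than the radii
    of the discs, as the recursion requires. *)
Lemma mean_Fav_le (E : Omega -> set (R * R)) :
  (forall w, E w `<=` \bigcup_(u in [set u : word | size u = n])
                        disc (center w u) (64 * delta)) ->
  mean P (fun w => Fav (E w)) <= (64 * 256 * pi / H)%:E.
Proof.
move=> hE; have H0 : (0 < H)%R by apply: resistance_gt0 => // k /andP[_ /r_gt0].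
apply: (@le_trans _ _ (\int[P]_w (64%:E * \int[mu]_(theta in `[0%R, pi]) sh theta w))).
  apply: ge0_le_integral_lower => w _.
    by apply: integral_ge0 => t _; exact: mu_ext_ge0.
  rewrite -ge0_integralZl//; last exact: measurable_sh_angle.
  apply: ge0_le_integral_lower => t _; first exact: mu_ext_ge0.
  have := @lebesgue_measure_cover_dilate _ _ (words n)
    (offset r (fun v => angle X phi v w) t [::]) delta 6 (ltW delta_gt0).
  have -> : (2 ^+ 6 = 64 :> R)%R by ring.
  apply: le_trans.
  apply: le_lebesgue_measure => _ [z /hE[u /= un hz] <-].
  apply/hasP; exists u; first by rewrite mem_words un.
  have : (line_proj t @` disc (center w u) (64 * delta)) (line_proj t z) by exists z.
  by rewrite line_proj_disc /= line_proj_center.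
rewrite ge0_integralZl//; last first.
  by move=> w _; apply: integral_ge0 => t _; exact: shadow_ge0.
rewrite shadow_fubini.
have -> : (64 * 256 * pi / H)%:E =
    64%:E * \int[mu]_(theta in `[0%R, pi]) (256 / H)%:E.
  rewrite integral_cst//= lebesgue_measure_itv/= lte_fin pi_gt0 sube0.
  by rewrite -!EFinM; congr (_%:E); ring.
apply: lee_wpmul2l => //; apply: ge0_le_integral_lower => t; rewrite /= in_itv/= => ht.
  by apply: integral_ge0 => w _; exact: shadow_ge0.
exact: (@mean_shadow_le _ _ _ P r t delta I X phi X_iid phi_fresh ht delta_gt0
  r_adm n r_gt0 delta_small [::] n (X_corr t) erefl).
Qed.

End mean_favard.

(** * The two models and the comparison *)

Section rotation_models.
Context d (Omega : measurableType d) (R : realType) (P : probability Omega R).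

(** Both models are a family of independent uniform angles read through a map
    [phi] on words: the length in one case, the identity in the other. *)
Lemma rotations_share_angles (omega : word -> {RV P >-> R}) :
  synchronized_rotations omega \/ independent_rotations omega ->
  exists (I : eqType) (X : I -> {RV P >-> R}) (phi : word -> I),
    [/\ iid_uniform_angles X,
        forall i v j, phi (v ++ j :: i) != phi i,
        forall r theta delta, 0 <= delta -> positively_correlated r theta delta X phi
      & forall w, (fun i => omega i w) = (fun i => angle X phi i w)].
Proof.
have longer (v i : word) j : size (v ++ j :: i) != size i.
  by rewrite size_cat /= -addSnnS -[X in _ != X]add0n eqn_add2r.
case=> [[a iid_a omegaE]|iid_omega].
  exists nat, a, (fun i => size i); split => //.
  - by move=> r theta delta d0; exact: synchronized_positively_correlated.
  - by move=> w; apply/funext => i; exact: omegaE.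
exists (seq 'I_4 : eqType), omega, id; split => //.
- by move=> i v j; apply: contra_neq (longer v i j) => ->.
- move=> r theta delta d0; apply: independent_positively_correlated => //.
  exact: iid_omega.1.
Qed.

End rotation_models.

Section comparisons.
Context {R : realType}.

Lemma recip_sum_fin (r : nat -> R) n : (forall k, (k < n)%N -> 0 < r k) ->
  recip_sum r n = (\sum_(0 <= j < n) (4 ^+ j * r j)^-1)%:E.
Proof.
move=> r0; rewrite /recip_sum -sumEFin; apply: eq_big_nat => j /andP[_ jn].
by rewrite inver mulf_eq0 expf_eq0 pnatr_eq0 andbF/= gt_eqF// r0.
Qed.

Lemma recip_sum_ge0 (r : nat -> R) n : (forall k, (k < n)%N -> 0 < r k) ->
  0 <= \sum_(0 <= j < n) (4 ^+ j * r j)^-1.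
Proof.
move=> r0; rewrite big_nat_cond; apply: sumr_ge0 => j /andP[/andP[_ jn] _].
by rewrite invr_ge0 mulr_ge0 ?exprn_ge0// ltW// r0.
Qed.

Context d (Omega : measurableType d) (P : probability Omega R).
Context (I : eqType) (X : I -> {RV P >-> R}) (phi : word -> I).
Variable r : nat -> R.
Hypothesis X_iid : iid_uniform_angles X.
Hypothesis phi_fresh : forall i v j, phi (v ++ j :: i) != phi i.
Hypothesis X_corr :
  forall theta delta, 0 <= delta -> positively_correlated r theta delta X phi.
Hypothesis r_adm : admissible r.
Local Notation center w u := (disc_center r (fun v => angle X phi v w) u).

Let r_ge0 k : 0 <= r k. Proof. by have [] := r_adm. Qed.

Lemma mean_Fav_lower (n : nat) (delta S : R) (E : Omega -> set (R * R)) :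
  0 < delta -> (forall k, (k < n)%N -> 20 * delta <= r k) ->
  0 < S -> resistance r delta 0 n <= 20 * S ->
  (forall w u, size u = n -> disc (center w u) delta `<=` E w) ->
  (((20 * 24)^-1)%:E * (S^-1)%:E <= mean P (fun w => Fav (E w)))%E.
Proof.
move=> d0 small S0 HS hE.
have r0 k : (k < n)%N -> 0 < r k.
  by move=> /small; apply: lt_le_trans; rewrite mulr_gt0.
have H0 : 0 < resistance r delta 0 n by apply: resistance_gt0 => // k /andP[_ /r0].
apply: le_trans (mean_Fav_ge X_iid phi_fresh d0 r_adm r0 small hE).
(* [48 * 20 = 2 * (20 * 24)] and [2 <= pi] *)
rewrite -EFinM lee_fin ler_pdivlMr ?mulr_gt0//; apply: le_trans (@pi_ge2 R).
have SV : S^-1 * S = 1 by rewrite mulVf// gt_eqF.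
have : S^-1 * resistance r delta 0 n <= S^-1 * (20 * S).
  by rewrite ler_wpM2l// invr_ge0 ltW.
by rewrite mulrCA SV; lra.
Qed.

Lemma mean_Fav_upper (n : nat) (delta S : R) (E : Omega -> set (R * R)) :
  0 < delta -> (forall k, (k < n)%N -> 20 * delta <= r k) ->
  0 < S -> S <= resistance r delta 0 n ->
  (forall w, E w `<=` \bigcup_(u in [set u : word | size u = n])
                        disc (center w u) (64 * delta)) ->
  (mean P (fun w => Fav (E w)) <= (64 * 32 * 32)%:E * (S^-1)%:E)%E.
Proof.
move=> d0 small S0 HS hE.
have r0 k : (k < n)%N -> 0 < r k.
  by move=> /small; apply: lt_le_trans; rewrite mulr_gt0.
have H0 : 0 < resistance r delta 0 n by apply: resistance_gt0 => // k /andP[_ /r0].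
have corr theta : positively_correlated r theta delta X phi by exact/X_corr/ltW.
apply: le_trans (mean_Fav_le X_iid phi_fresh corr d0 r_adm r0 small hE) _.
rewrite -EFinM lee_fin.
have pi4 : pi <= 4 :> R by have := @pihalf_lt2 R; lra.
have HV : (resistance r delta 0 n)^-1 <= S^-1 by rewrite lef_pV2 ?posrE.
have SV : 0 < S^-1 by rewrite invr_gt0.
have pH : pi * (resistance r delta 0 n)^-1 <= 4 * S^-1.
  by apply: ler_pM => //; [exact: pi_ge0|rewrite invr_ge0 ltW].
by rewrite -mulrA; lra.
Qed.

(** The projection is then a finite set, while the comparison function is 0. *)
Lemma mean_Fav_level_degenerate n : r n = 0 ->
  (mean P (fun w => Fav (cantor_level r (fun i => angle X phi i w) n)) <= 0)%E.
Proof.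
move=> rn0.
rewrite -[leRHS](integral0 P setT).
apply: ge0_le_integral_lower => w _; first by apply: integral_ge0 => t _; exact: mu_ext_ge0.
rewrite -[leRHS](integral0 (@lebesgue_measure R) `[0%R, pi]).
apply: ge0_le_integral_lower => t _; first exact: mu_ext_ge0.
pose y := offset r (fun v => angle X phi v w) t [::].
apply: (@le_trans _ _ (lebesgue_measure (interval_cover (words n) y 0))); last first.
  by apply: le_trans (lebesgue_measure_cover_le _ _ (lexx 0)) _; rewrite !mulr0.
apply: le_lebesgue_measure => _ [z [u /= un uz] <-].
apply/hasP; exists u; first by rewrite mem_words un.
rewrite /y -line_proj_disc_center.
apply: le_trans (line_proj_lipschitz _ _ _) _; rewrite eucl_distC.
by apply: le_trans uz _; rewrite un rn0.
Qed.

Lemma comparable_level n :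
  comparable_with (20 * 24)^-1 (64 * 32 * 32)
    (mean P (fun w => Fav (cantor_level r (fun i => angle X phi i w) n)))
    ((recip_sum r n.+1)^-1)%E.
Proof.
have [rn0|rn0] := eqVneq (r n) 0.
  have -> : recip_sum r n.+1 = +oo%E.
    rewrite /recip_sum big_nat_recr//= rn0 mulr0 inve0 addey// gt_eqF//.
    rewrite (lt_le_trans (ltNyr 0))//; apply: sume_ge0 => j _.
    by rewrite inve_ge0 lee_fin mulr_ge0// exprn_ge0.
  rewrite invey /comparable_with !mule0; split; last exact: mean_Fav_level_degenerate.
  by apply: integral_ge0 => w _; apply: integral_ge0 => t _; exact: mu_ext_ge0.
have rn : 0 < r n by rewrite lt_neqAle eq_sym rn0 r_ge0.
have r0 k : (k < n.+1)%N -> 0 < r k.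
  by rewrite ltnS => kn; apply: lt_le_trans rn _; exact: radius_decreasing.
have sub : forall k, (k < n)%N -> 0 < r k by move=> k kn; apply: r0; exact: ltnW.
set T := \sum_(0 <= j < n) (4 ^+ j * r j)^-1.
have T0 : 0 <= T by exact: recip_sum_ge0.
set U := (4 ^+ n * r n)^-1.
have U0 : 0 < U by rewrite invr_gt0 mulr_gt0// exprn_gt0.
have TU : 0 < T + U by rewrite ltr_wpDl.
rewrite recip_sum_fin// big_nat_recr//= -/T -/U inver gt_eqF//.
pose delta := r n / 20.
have d0 : 0 < delta by rewrite divr_gt0.
have small k : (k < n)%N -> 20 * delta <= r k.
  move=> kn; rewrite /delta mulrC divfK//; apply: radius_decreasing => //.
  exact: ltnW.
have HE : resistance r delta 0 n = T + 20 * U.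
  rewrite resistanceE /T; congr (_ + _); rewrite /U /delta !invfM invrK.
  by ring.
split.
- apply: (@mean_Fav_lower n delta) => //; first by rewrite HE; lra.
  move=> w u un x hx; exists u => //; rewrite /cantor_disc /disc /= un.
  by apply: le_trans hx _; rewrite /delta; lra.
- apply: (@mean_Fav_upper n delta) => //; first by rewrite HE; lra.
  move=> w x [u /= un hx]; exists u => //; move: hx.
  rewrite /cantor_disc /disc /= un => /le_trans; apply.
  by rewrite /delta; lra.
Qed.

(** The upper bound compares with the discs of level [n]. So does the lower one
    if [rho] is at least twice [r n], since a disc of level [n] contains a point
    of the limit set within [r n] of its centre. Otherwise [r n] and [rho] are
    comparable, and the discs of level [n.+1], whose radius is at most
    [rho / 3], serve instead: the additional term of the sum is absorbed. *)
Lemma comparable_neighborhood n rho : 0 < rho -> r n <= rho ->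
  (rho%:E <= prev_radius r n)%E ->
  comparable_with (20 * 24)^-1 (64 * 32 * 32)
    (mean P (fun w =>
       Fav (neighborhood (cantor_limit r (fun i => angle X phi i w)) rho)))
    ((recip_sum r n + ((4 ^+ n * rho)%R%:E)^-1)^-1)%E.
Proof.
move=> rho0 rn hrho.
have rk k : (k < n)%N -> rho <= r k.
  case: n hrho {rn} => // n'; rewrite /= lee_fin ltnS => h kn.
  by apply: (le_trans h); exact: radius_decreasing.
have r0 k : (k < n)%N -> 0 < r k by move=> /rk; exact: lt_le_trans.
set T := \sum_(0 <= j < n) (4 ^+ j * r j)^-1.
have T0 : 0 <= T by exact: recip_sum_ge0.
set U := (4 ^+ n * rho)^-1.
have e0 : 0 < 4 ^+ n :> R by rewrite exprn_gt0.
have U0 : 0 < U by rewrite invr_gt0 mulr_gt0.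
have TU : 0 < T + U by rewrite ltr_wpDl.
rewrite recip_sum_fin// -/T inver gt_eqF ?mulr_gt0// -/U -EFinD inver gt_eqF//.
pose delta := rho / 20.
have d0 : 0 < delta by rewrite divr_gt0.
have small k : (k < n)%N -> 20 * delta <= r k.
  by move=> kn; rewrite /delta mulrC divfK//; exact: rk.
have HE : resistance r delta 0 n = T + 20 * U.
  by rewrite resistanceE /T; congr (_ + _); rewrite /U /delta !invfM invrK; ring.
split; last first.
  apply: (@mean_Fav_upper n delta) => //; first by rewrite HE; lra.
  move=> w x /(neighborhood_sub_discs rho0 rn)[u un hx]; exists u => //.
  by apply: le_trans hx _; rewrite /delta; lra.
have [h|h] := leP (2 * r n) rho.
  apply: (@mean_Fav_lower n delta) => //; first by rewrite HE; lra.
  move=> w u un x hx; apply: (@disc_sub_neighborhood _ r r_adm (fun v => angle X phi v w) u rho).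
  by apply: le_trans hx _; rewrite un /delta; lra.
have r1 : 3 * r n.+1 <= r n by have [_ _ /(_ n)] := r_adm; lra.
(* [20 * delta' <= r n] now has to hold as well *)
pose delta' := rho / 40.
have rn0 : 0 < r n by lra.
apply: (@mean_Fav_lower n.+1 delta') => //.
- by rewrite divr_gt0.
- move=> k; rewrite ltnS leq_eqVlt => /predU1P[->|/rk]; rewrite /delta'; lra.
- rewrite resistanceE big_nat_recr//= add0n -/T.
  have : (4 ^+ n * r n)^-1 <= 2 * U.
    rewrite (_ : 2 * U = (4 ^+ n * (rho / 2))^-1); last first.
      by rewrite /U !invfM invrK; ring.
    by rewrite lef_pV2 ?posrE ?mulr_gt0 ?divr_gt0// ler_wpM2l ?ltW//; lra.
  have -> : (4 ^+ n.+1 * delta')^-1 = 10 * U.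
    by rewrite exprS /U /delta' !invfM invrK; field; rewrite !gt_eqF.
  by lra.
- move=> w u un x hx; apply: (@disc_sub_neighborhood _ r r_adm (fun v => angle X phi v w) u rho).
  by apply: le_trans hx _; rewrite un /delta'; lra.
Qed.

End comparisons.

Unset Implicit Arguments.

Theorem theorem1p3 (R : realType) :
  exists c C : R, [/\ 0 < c, c <= C &
    forall (r : nat -> R), admissible r ->
    forall (d : measure_display) (Omega : measurableType d)
      (P : probability Omega R) (omega : word -> {RV P >-> R}),
      synchronized_rotations omega \/ independent_rotations omega ->
      (forall n : nat,
        comparable_with c C
          (mean P (fun w => Fav (cantor_level r (fun i => omega i w) n)))
          ((recip_sum r n.+1)^-1)%E)
      /\
      (forall (n : nat) (rho : R), 0 < rho -> r n <= rho ->
        (rho%:E <= prev_radius r n)%E ->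
        comparable_with c C
          (mean P (fun w =>
             Fav (neighborhood (cantor_limit r (fun i => omega i w)) rho)))
          ((recip_sum r n + ((4 ^+ n * rho)%R%:E)^-1)^-1)%E)].
exists (20 * 24)^-1, (64 * 32 * 32); split; first by rewrite invr_gt0 mulr_gt0.
  apply: (@le_trans _ _ 1); first by rewrite invf_le1 ?mulr_gt0 ?mulr_ege1 ?ler1n.
  by rewrite !mulr_ege1 ?ler1n.
move=> r r_adm d Omega P omega model.
have [I [X [phi [X_iid phi_fresh X_corr omegaE]]]] := rotations_share_angles model.
split=> [n|n rho rho0 rn hrho].
  under eq_fun do rewrite omegaE.
  exact: (comparable_level X_iid phi_fresh (X_corr r) r_adm).
under eq_fun do rewrite omegaE.
exact: (comparable_neighborhood X_iid phi_fresh (X_corr r) r_adm).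
Qed.
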